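(* For each $n\ge2$ let $N=\frac{n(n-1)}{2}$, let $P_1,\dots,P_N$ be i.i.d. draws from the normalized Haar measure on $\mathrm{SO}(n)$, and let $D_\infty$ be the symmetric $N\times N$ random matrix with $D_\infty[i,i]=1$ for all $i$, $$D_\infty[i,j]=-\mathrm{Tr}\Big[a_i\Big(\prod_{\ell=i+1}^{j}P_\ell\Big)a_j\Big(\prod_{\ell=i+1}^{j}P_\ell\Big)^{-1}\Big]\quad\text{for } i<j,$$ and $D_\infty[i,j]=D_\infty[j,i]$ for $i>j$. Let $\sigma_1(D_\infty)$ be the smallest singular value of $D_\infty$. Then, as $n\to\infty$, $$\mathbb{P}\big[\sigma_1(D_\infty)\le N^{-N}(4N^{21})^{-4(N+1)}\big]=o(1).$$
   Context: Products are ordered as $\prod_{\ell=i+1}^{j}P_\ell=P_{i+1}P_{i+2}\cdots P_j$. Fix an ordering of the $N$ pairs $1\le k<\ell\le n$ (coordinate planes of $\mathbb{R}^n$). If the $i$-th pair is $(k,\ell)$, $a_i$ is the skew-symmetric $n\times n$ matrix with $(a_i)_{k\ell}=\frac{1}{\sqrt2}$, $(a_i)_{\ell k}=-\frac{1}{\sqrt2}$ and all other entries $0$; thus $a_1,\dots,a_N$ is an orthonormal basis of the skew-symmetric matrices for the inner product $\langle A,B\rangle=\mathrm{Tr}(A^{\dagger}B)$, where $A^\dagger$ is the transpose. *)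

(* Defs.v *)
From HB Require Import structures.
From mathcomp Require Import all_boot all_order all_algebra.
From mathcomp Require Import all_classical all_reals all_analysis.

Set Implicit Arguments.
Unset Strict Implicit.
Unset Printing Implicit Defensive.

Import Order.TTheory GRing.Theory Num.Theory.
Import numFieldNormedType.Exports.

Local Open Scope classical_set_scope.
Local Open Scope ring_scope.

Definition mx_borel (R : realType) (n : nat) :
    measurableType (@open 'M[R]_n).-sigma :=
  g_sigma_algebraType (@open 'M[R]_n).

Definition SO (R : realType) (n : nat) : set 'M[R]_n :=
  [set A | A *m A^T = 1%:M /\ \det A = 1].

(* A measure on SO(n) is represented as a Borel measure on the space of n x n
   matrices that is carried by the closed subset SO(n). *)
Definition normalized_haar_SO (R : realType) (n : nat)
    (mu : probability (mx_borel R n) R) : Prop :=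
  mu (@SO R n : set (mx_borel R n)) = 1%E /\
  forall (g : 'M[R]_n) (B : set (mx_borel R n)),
    SO g -> measurable B -> mu [set g *m (A : 'M[R]_n) | A in B] = mu B.

Definition mutually_independent (d d' : measure_display) (T : measurableType d)
    (T' : measurableType d') (R : realType) (P : probability T R)
    (I : finType) (X : I -> {RV P >-> T'}) : Prop :=
  forall (J : {set I}) (B : I -> set T'),
    (forall i, i \in J -> measurable (B i)) ->
    P (\bigcap_(i in [set` J]) (X i @^-1` B i)) =
    (\prod_(i in J) P (X i @^-1` B i))%E.

Definition identically_distributed (d d' : measure_display)
    (T : measurableType d) (T' : measurableType d') (R : realType)
    (P : probability T R) (I : Type) (X : I -> {RV P >-> T'})
    (mu : probability T' R) : Prop :=
  forall (i : I) (B : set T'), measurable B -> distribution P (X i) B = mu B.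

Definition nb_planes (n : nat) : nat := (n * n.-1) %/ 2.

Definition plane_ordering (n : nat) (e : 'I_(nb_planes n) -> 'I_n * 'I_n) :
    Prop :=
  injective e /\ forall p : 'I_n * 'I_n, (p.1 < p.2)%N <-> exists i, e i = p.

Definition plane_mx (R : realType) (n : nat) (p : 'I_n * 'I_n) : 'M[R]_n :=
  (Num.sqrt 2)^-1 *: (delta_mx p.1 p.2 - delta_mx p.2 p.1).

Section D_infinity.
Variables (R : realType) (n : nat) (e : 'I_(nb_planes n) -> 'I_n * 'I_n).
Variable P : 'I_(nb_planes n) -> 'M[R]_n.

(* With indices starting at 0, P_(i+1) ... P_j is still the product, in
   increasing order, of the P_l with i < l <= j. *)
Definition path_prod (i j : 'I_(nb_planes n)) : 'M[R]_n :=
  \prod_(l < nb_planes n | (i < l <= j)%N) P l.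

Definition D_upper (i j : 'I_(nb_planes n)) : R :=
  - \tr (plane_mx R (e i) *m path_prod i j *m
         plane_mx R (e j) *m invmx (path_prod i j)).

Definition D_infty : 'M[R]_(nb_planes n) :=
  \matrix_(i, j) if i == j then 1
                 else if (i < j)%N then D_upper i j else D_upper j i.

End D_infinity.

Definition singular_values (R : realType) (m : nat) (A : 'M[R]_m) : set R :=
  [set Num.sqrt a | a in [set a | eigenvalue (A^T *m A) a]].

(* For m > 0 the set of singular values is finite and nonempty, so this
   infimum is a minimum. *)
Definition smallest_singular_value (R : realType) (m : nat) (A : 'M[R]_m) : R :=
  inf (singular_values A).

(* Main.v *)
Require Import Defs.
From HB Require Import structures.
From mathcomp Require Import all_boot all_order all_algebra.
From mathcomp Require Import all_classical all_reals all_analysis.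
From mathcomp Require Import measurable_realfun ring lra zify.
Import Order.TTheory GRing.Theory Num.Theory.
Import numFieldNormedType.Exports.
Local Open Scope classical_set_scope.
Local Open Scope ring_scope.

(** Write Q_i = P_1 ... P_i and v_i = Q_i a_i Q_i^T.  When all P_i are
    rotations, D_infty is the Gram matrix of v_1, ..., v_N, which are as many
    unit vectors as the dimension of the space of skew-symmetric matrices.  If
    its smallest singular value is at most eps, then some v_i lies within
    squared distance 2 eps N of the span of the others
    (near_span_of_small_singular_value).  By the union bound it remains to make
    the probability of this event, for each i, small compared with 1/N.

    Replacing P_i by P_i h and P_(i+1) by h^T P_(i+1), with h a rotation, turns
    Q_i into Q_i h and leaves every other Q_j alone, so it moves v_i only
    (gram_vec_twist).  It does not change the law of the family, because Haar
    measure is invariant on both sides and the P_i are independent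
    (haar_right, law_invariant).  Hence the probability of the event is also
    its average over any finite collection of rotations h, and it is enough to
    find, whatever P is, M^2 rotations few of which bring v_i close to the span
    of the other vectors (prob_le_of_overlap).

    For fixed P, let w be a unit normal to the span of the v_j with j <> i, and
    W = Q_i^T w Q_i.  Being close to that span forces the inner product of W
    with h a_i h^T to be tiny.  For integers 0 <= s, t < M choose h carrying the
    coordinate plane of a_i to the plane of the moment vectors
    m(t) = (1, t, ..., t^(n-1)) and m(s), any h if s = t (wedge_SO).  Then the
    sum of W_ab t^a s^b over a and b is tiny too, as it is the inner product
    times at most the norms of m(t) and m(s).  A polynomial of
    degree less than n with a coefficient that is not tiny takes tiny values at
    fewer than n of the M integers (card_small_values); used in s, then in t,
    this shows that at most 2nM of the M^2 pairs are bad (card_bad_twists).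

    With M = n^4 the total is at most N (2n / M) <= 1/n.  All the factors lost
    on the way amount to n^(O(n)), while the threshold is at most
    N^(-N) = n^(-Omega(n^2)) (threshold_bound).

    The events are measurable because each says that a quadratic form whose
    coefficients are measurable takes a negative value, which can be tested on
    rational vectors (measurable_exists_qform_lt0). *)

Set Implicit Arguments.
Unset Strict Implicit.

(** * Polynomials with few small values *)

(** Induction on the number of sample points: p - p(t) = q (X - t), and since
    distinct integers are at distance at least 1, the values of q at the other
    points are at most 2 eta.  Each division costs a factor linear in T. *)
Lemma coef_le_of_small_values (R : realFieldType) (T : nat) (eta : R)
    (s : seq nat) (p : {poly R}) :
  0 <= eta -> uniq s -> (forall t, t \in s -> (t <= T)%N) ->
  (size p <= size s)%N -> (forall t, t \in s -> `|p.[t%:R]| <= eta) ->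
  forall i, `|p`_i| <= (2 * T%:R + 3) ^+ size s * eta.
Proof.
elim: s p eta => [|t s IH] p eta eta0 /=.
  move=> _ _; rewrite leqn0 size_poly_eq0 => /eqP -> _ i.
  by rewrite coef0 normr0 mulr_ge0 ?exprn_ge0.
move=> /andP[ts us] sT sp ps i.
have [q pq] : exists q, p - p.[t%:R]%:P = q * ('X - t%:R%:P).
  by apply/factor_theorem; rewrite /root !hornerE subrr.
have sq : (size q <= size s)%N.
  have [->|q0] := eqVneq q 0; first by rewrite size_poly0.
  have := size_Mmonic q0 (monicXsubC t%:R).
  rewrite size_XsubC addn2 /= -pq => h.
  rewrite -ltnS -h (leq_trans (size_polyD _ _)) // geq_max sp size_polyN.
  by rewrite (leq_trans (size_polyC_leq1 _)).
have dpt : forall x, p.[x] = p.[t%:R] + q.[x] * (x - t%:R).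
  by move=> x; apply/eqP; rewrite addrC -subr_eq -[X in _ - X](hornerC _ x) -hornerN -hornerD pq !hornerE.
have pt : `|p.[t%:R]| <= eta by apply: ps; rewrite mem_head.
have qs t' : t' \in s -> `|q.[t'%:R]| <= 2 * eta.
  move=> t's; have t't : t' != t by apply: contraNneq ts => <-.
  have := ps t'; rewrite inE t's orbT dpt => /(_ isT) h.
  have h2 : `|q.[t'%:R] * (t'%:R - t%:R)| <= 2 * eta.
    rewrite -[_ * _](addKr p.[t%:R]) (le_trans (ler_normD _ _)) // normrN.
    by rewrite mulrDl mul1r lerD.
  apply: le_trans h2; rewrite normrM ler_peMr //.
  clear - t't; wlog tt' : t t' t't / (t < t')%N.
    move=> W; move: (t't); rewrite neq_ltn => /orP[] tt'; last exact: W.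
    by rewrite distrC; apply: W; rewrite // eq_sym.
  by rewrite -natrB ?(ltnW tt')// normr_nat ler1n subn_gt0.
have K1 : (1 : R) <= 2 * T%:R + 3 by have := ler0n R T; lra.
have qi j : `|q`_j| <= (2 * T%:R + 3) ^+ size s * (2 * eta).
  by apply: IH => //; [lra|move=> u us'; apply: sT; rewrite inE us' orbT].
have tT : t%:R <= T%:R :> R by rewrite ler_nat sT ?mem_head.
have -> : p = p.[t%:R]%:P + q * 'X - t%:R *: q.
  rewrite -[LHS](subrK p.[t%:R]%:P) pq mulrBr addrC -mul_polyC.
  by rewrite [q * _%:P]mulrC addrA.
rewrite coefB coefD coefZ coefMX coefC.
have X0 : 1 <= (2 * T%:R + 3) ^+ size s :> R by rewrite exprn_ege1.
set X := _ ^+ _ in X0 qi *.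
have Xe : eta <= X * eta by rewrite ler_peMl.
rewrite exprS -/X.
have E0 : `|if i == 0%N then p.[t%:R] else 0| <= eta by case: ifP; rewrite ?normr0.
have E1 : `|if i == 0%N then 0 else q`_i.-1| <= X * (2 * eta).
  by case: ifP; rewrite ?normr0 // mulr_ge0 //; lra.
have E2 : `|t%:R * q`_i| <= T%:R * (X * (2 * eta)).
  by rewrite normrM ler_pM // ger0_norm.
apply: le_trans (ler_normB _ _) _.
apply: le_trans (lerD (le_trans (ler_normD _ _) (lerD E0 E1)) E2) _.
nra.
Qed.

(** With n sample points at which the polynomial is small, interpolation would
    make all its n coefficients small. *)
Lemma card_small_values (R : realFieldType) (n T : nat) (I : finType)
    (f : I -> nat) (c : 'I_n -> R) (a : 'I_n) (eta : R) :
  injective f -> (forall i, (f i <= T)%N) -> 0 <= eta ->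
  (2 * T%:R + 3) ^+ n * eta < `|c a| ->
  (#|[set i | (`|\sum_b c b * (f i)%:R ^+ b| <= eta)%R]%SET| < n)%N.
Proof.
move=> finj fT eta0 ca; rewrite ltnNge; apply/negP => nA.
set A := finset _ in nA.
pose p : {poly R} := \poly_(b < n) (if insub b is Some b' then c b' else 0).
have pE x : p.[x] = \sum_b c b * x ^+ b.
  by rewrite horner_poly; apply: eq_bigr => b _; rewrite valK.
pose s := [seq f i | i <- take n (enum A)].
have ss : size s = n.
  by rewrite size_map size_takel // -cardE.
have := @coef_le_of_small_values R T eta s p eta0.
rewrite ss => /(_ _ _ (size_poly _ _) _ a); rewrite coef_poly ltn_ord valK.
move=> h; suff : `|c a| <= (2 * T%:R + 3) ^+ n * eta by rewrite leNgt ca.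
apply: h.
- by rewrite map_inj_uniq // take_uniq // enum_uniq.
- by move=> t /mapP[i _ ->].
- move=> t /mapP[i /mem_take]; rewrite mem_enum inE => h ->.
  by rewrite pE.
Qed.

(** * The Frobenius inner product and reflections *)

(** The Frobenius inner product of matrices; on columns and rows it is the
    Euclidean one. *)
Definition fdot (R : pzRingType) m n (A B : 'M[R]_(m, n)) : R := \tr (A^T *m B).

Section Fdot.
Variable R : realFieldType.
Implicit Types m n : nat.

Lemma fdotE m n (A B : 'M[R]_(m, n)) : fdot A B = \sum_j \sum_i A i j * B i j.
Proof.
rewrite /fdot /mxtrace; apply: eq_bigr => j _; rewrite mxE.
by apply: eq_bigr => i _; rewrite mxE.
Qed.

Lemma fdot_cV n (u v : 'cV[R]_n) : u^T *m v = (fdot u v)%:M.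
Proof. by rewrite [LHS]mx11_scalar /fdot /mxtrace big_ord1. Qed.

Lemma fdotC m n (A B : 'M[R]_(m, n)) : fdot A B = fdot B A.
Proof. by rewrite !fdotE; do 2!apply: eq_bigr => ? _; rewrite mulrC. Qed.

Lemma fdotDr m n (A B C : 'M[R]_(m, n)) : fdot A (B + C) = fdot A B + fdot A C.
Proof. by rewrite /fdot mulmxDr mxtraceD. Qed.

Lemma fdotZr m n k (A B : 'M[R]_(m, n)) : fdot A (k *: B) = k * fdot A B.
Proof. by rewrite /fdot -scalemxAr mxtraceZ. Qed.

Lemma fdotBr m n (A B C : 'M[R]_(m, n)) : fdot A (B - C) = fdot A B - fdot A C.
Proof. by rewrite -scaleN1r fdotDr fdotZr mulN1r. Qed.

Lemma fdot0r m n (A : 'M[R]_(m, n)) : fdot A 0 = 0.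
Proof. by rewrite /fdot mulmx0 mxtrace0. Qed.

Lemma fdot_sumr m n (I : Type) (r : seq I) (P : pred I) (A : 'M[R]_(m, n)) B :
  fdot A (\sum_(i <- r | P i) B i) = \sum_(i <- r | P i) fdot A (B i).
Proof. by rewrite /fdot mulmx_sumr raddf_sum. Qed.

Lemma fdotZl m n k (A B : 'M[R]_(m, n)) : fdot (k *: B) A = k * fdot B A.
Proof. by rewrite -!(fdotC A) fdotZr. Qed.

Lemma fdotBl m n (A B C : 'M[R]_(m, n)) : fdot (B - C) A = fdot B A - fdot C A.
Proof. by rewrite -!(fdotC A) fdotBr. Qed.

Lemma fdot_suml m n (I : Type) (r : seq I) (P : pred I) (A : 'M[R]_(m, n)) B :
  fdot (\sum_(i <- r | P i) B i) A = \sum_(i <- r | P i) fdot (B i) A.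
Proof. by rewrite fdotC fdot_sumr; apply: eq_bigr => i _; rewrite fdotC. Qed.

Lemma fdot_ge0 m n (A : 'M[R]_(m, n)) : 0 <= fdot A A.
Proof. by rewrite fdotE; do 2!apply: sumr_ge0 => ? _; rewrite -expr2 sqr_ge0. Qed.

Lemma fdot_eq0 m n (A : 'M[R]_(m, n)) : (fdot A A == 0) = (A == 0).
Proof.
apply/eqP/eqP => [|->]; last exact: fdot0r.
rewrite fdotE => h; apply/matrixP => i j; rewrite mxE.
have h1 : \sum_i A i j * A i j = 0.
  move/psumr_eq0P: h; apply => // k _.
  by apply: sumr_ge0 => ? _; rewrite -expr2 sqr_ge0.
have : A i j * A i j = 0.
  by move/psumr_eq0P: h1; apply => // k _; rewrite -expr2 sqr_ge0.
by move=> /eqP; rewrite mulf_eq0 orbb => /eqP.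
Qed.

Lemma fdot_gt0 m n (A : 'M[R]_(m, n)) : A != 0 -> 0 < fdot A A.
Proof. by move=> A0; rewrite lt_neqAle fdot_ge0 andbT eq_sym fdot_eq0. Qed.

(** The Cauchy-Schwarz inequality. *)
Lemma fdot_CS m n (A B : 'M[R]_(m, n)) :
  fdot A B ^+ 2 <= fdot A A * fdot B B.
Proof.
have [->|B0] := eqVneq B 0; first by rewrite !fdot0r expr0n mulr0.
have b0 := fdot_gt0 B0.
have := fdot_ge0 (fdot B B *: A - fdot A B *: B).
rewrite fdotBr !fdotBl !fdotZr !fdotZl (fdotC B A).
set a := fdot A A; set b := fdot B B in b0 *; set c := fdot A B => h.
have : 0 <= b * (a * b - c ^+ 2) by apply: le_trans h _; rewrite le_eqVlt; apply/orP; left; apply/eqP; ring.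
by rewrite pmulr_rge0 // subr_ge0.
Qed.

Lemma fdot_mulmxl m n p (Q : 'M[R]_(m, n)) (A : 'M[R]_(m, p)) (B : 'M[R]_(n, p)) :
  fdot A (Q *m B) = fdot (Q^T *m A) B.
Proof. by rewrite /fdot trmx_mul trmxK mulmxA. Qed.

Lemma fdot_mulmxr m n p (Q : 'M[R]_(n, p)) (A : 'M[R]_(m, p)) (B : 'M[R]_(m, n)) :
  fdot A (B *m Q) = fdot (A *m Q^T) B.
Proof. by rewrite /fdot trmx_mul trmxK mulmxA mxtrace_mulC mulmxA. Qed.

Lemma sqr_entry_le_fdot m n (A : 'M[R]_(m, n)) i j : A i j ^+ 2 <= fdot A A.
Proof.
rewrite fdotE (bigD1 j) //= (bigD1 i) //= -expr2 -addrA lerDl addr_ge0 //.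
  by apply: sumr_ge0 => ? _; rewrite -expr2 sqr_ge0.
by do 2!apply: sumr_ge0 => ? _; rewrite -expr2 sqr_ge0.
Qed.

(** The largest squared entry is at least the average one. *)
Lemma fdot_large_entry m n (A : 'M[R]_(m, n)) : A != 0 ->
  exists i j, fdot A A <= (m * n)%:R * A i j ^+ 2.
Proof.
move=> A0; apply: contrapT => h.
have h' i j : (m * n)%:R * A i j ^+ 2 < fdot A A.
  by rewrite ltNge; apply/negP => k; apply: h; exists i, j.
have [i0 [j0 _]] : exists i j, A i j != 0.
  apply: contrapT => h2; move/eqP: A0; apply; apply/matrixP => i j; rewrite mxE.
  by apply/eqP; apply: contrapT => /negP k; apply: h2; exists i, j.
have : \sum_(j < n) \sum_(i < m) (m * n)%:R * A i j ^+ 2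
       < \sum_(j < n) \sum_(i < m) fdot A A.
  apply: ltr_sum; first by apply/hasP; exists j0 => //; rewrite mem_index_enum.
  by move=> j _; apply: ltr_sum => [|i _ //]; apply/hasP; exists i0; rewrite // mem_index_enum.
rewrite !sumr_const !card_ord -mulrnA -[X in _ < X]mulr_natl.
under eq_bigr do rewrite -mulr_sumr.
rewrite -mulr_sumr fdotE; under [X in _ < _ * X]eq_bigr do under eq_bigr do rewrite -expr2.
by rewrite ltxx.
Qed.

End Fdot.

Definition orthomx (R : realFieldType) n (H : 'M[R]_n) := H *m H^T = 1%:M.

Lemma orthomx_tr (R : realFieldType) n (H : 'M[R]_n) : orthomx H -> H^T *m H = 1%:M.
Proof. exact: mulmx1C. Qed.

Lemma orthomxM (R : realFieldType) n (H G : 'M[R]_n) :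
  orthomx H -> orthomx G -> orthomx (H *m G).
Proof.
rewrite /orthomx => h g.
by rewrite trmx_mul mulmxA -(mulmxA H) g mulmx1.
Qed.

Lemma fdot_orthol (R : realFieldType) n p (H : 'M[R]_n) (A B : 'M[R]_(n, p)) :
  orthomx H -> fdot (H *m A) (H *m B) = fdot A B.
Proof. by move=> h; rewrite fdot_mulmxl mulmxA orthomx_tr // mul1mx. Qed.

Lemma fdot_conj (R : realFieldType) n (H : 'M[R]_n) (A B : 'M[R]_n) :
  orthomx H -> fdot (H *m A *m H^T) (H *m B *m H^T) = fdot A B.
Proof.
move=> h; rewrite fdot_mulmxr trmxK -mulmxA orthomx_tr // mulmx1.
exact: fdot_orthol.
Qed.

(** The reflection in the hyperplane orthogonal to u - v.  The vectors it fixes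
    include those orthogonal to both u and v, so that several orthonormal
    vectors can be placed one after the other. *)
Lemma householder (R : realFieldType) n (u v : 'cV[R]_n) :
  fdot u u = fdot v v ->
  exists H : 'M[R]_n, [/\ orthomx H, H *m u = v &
    forall w, fdot w u = fdot w v -> H *m w = w].
Proof.
move=> uv; have [->|uv0] := eqVneq u v.
  by exists 1%:M; split => [||w _]; rewrite /orthomx ?trmx1 ?mul1mx.
pose z := u - v; have z0 : z != 0 by rewrite subr_eq0.
have zz := fdot_gt0 z0.
pose H : 'M[R]_n := 1%:M - (2 / fdot z z) *: (z *m z^T).
have Hw w : H *m w = w - (2 * fdot z w / fdot z z) *: z.
  rewrite /H mulmxBl mul1mx -scalemxAl -mulmxA.
  by rewrite fdot_cV mul_mx_scalar scalerA mulrAC.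
have sH : H^T = H.
  by rewrite /H linearB /= trmx1 linearZ /= trmx_mul trmxK.
exists H; split.
- have Hz : H *m z = - z.
    by rewrite Hw mulfK ?lt0r_neq0 // scaler_nat mulr2n opprD addrA subrr add0r.
  rewrite /orthomx sH {2}/H mulmxBr mulmx1 -scalemxAr mulmxA Hz mulNmx scalerN.
  by rewrite opprK /H subrK.
- have h : 2 * fdot z u = fdot z z.
    rewrite /z !fdotBr !fdotBl -uv (fdotC v u); ring.
  by rewrite Hw h divff ?lt0r_neq0 // scale1r /z subKr.
- by move=> w wuv; rewrite Hw fdotC /z fdotBr wuv subrr mulr0 mul0r scale0r subr0.
Qed.

(** * Rotating coordinate planes *)

(** The bivector x /\ y as a skew-symmetric matrix: for orthonormal x and y it
    is, up to scaling, the generator of the rotations of their plane. *)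
Definition wedge (R : pzRingType) n (x y : 'cV[R]_n) : 'M[R]_n :=
  x *m y^T - y *m x^T.

Section Wedge.
Variables (R : realType) (n : nat).
Implicit Types (x y : 'cV[R]_n) (W h : 'M[R]_n) (p q : 'I_n).

Lemma wedge_conj h x y : h *m wedge x y *m h^T = wedge (h *m x) (h *m y).
Proof. by rewrite /wedge mulmxBr mulmxBl !trmx_mul !mulmxA. Qed.

Lemma wedgeZl k x y : wedge (k *: x) y = k *: wedge x y.
Proof. by rewrite /wedge linearZ /= -scalemxAl -scalemxAr scalerBr. Qed.

Lemma wedgeZr k x y : wedge x (k *: y) = k *: wedge x y.
Proof. by rewrite /wedge linearZ /= -scalemxAl -scalemxAr scalerBr. Qed.

Lemma wedgeBr x y z : wedge x (y - z) = wedge x y - wedge x z.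
Proof.
rewrite /wedge linearB /= mulmxBr mulmxBl !opprB [LHS]addrACA [RHS]addrACA.
by congr (_ + _); rewrite addrC.
Qed.

Lemma wedgexx x : wedge x x = 0.
Proof. exact: subrr. Qed.

Lemma wedge_tr x y : (wedge x y)^T = - wedge x y.
Proof. by rewrite /wedge linearB /= !trmx_mul !trmxK opprB. Qed.

Lemma fdot_wedge W x y : W^T = - W -> fdot W (wedge x y) = 2 * fdot x (W *m y).
Proof.
move=> skW; have WC : fdot (W *m x) y = - fdot x (W *m y).
  by rewrite fdotC fdot_mulmxl skW mulNmx -scaleN1r fdotZl mulN1r fdotC.
by rewrite /wedge fdotBr !(fdot_mulmxr _ W) !trmxK WC opprK fdotC mulr_natl mulr2n.
Qed.

Lemma fdot_delta_l p x : fdot (delta_mx p 0) x = x p 0.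
Proof.
rewrite fdotE big_ord1 (bigD1 p) //= mxE !eqxx mul1r big1 ?addr0 // => i ip.
by rewrite mxE (negbTE ip) mul0r.
Qed.

Lemma fdot_delta p q : fdot (delta_mx p 0 : 'cV[R]_n) (delta_mx q 0) = (p == q)%:R.
Proof. by rewrite fdot_delta_l mxE eqxx andbT. Qed.

(** Reversing one axis, if needed, makes the determinant 1. *)
Lemma SO_fix_sign h p : orthomx h -> exists (D : 'M[R]_n) (s : R),
  [/\ SO (h *m D), s ^+ 2 = 1, D *m delta_mx p 0 = s *: (delta_mx p 0 : 'cV_n) &
      forall q, q != p -> D *m delta_mx q 0 = (delta_mx q 0 : 'cV_n)].
Proof.
move=> oh.
have d1 : \det h ^+ 2 = 1.
  by have := congr1 determinant oh; rewrite det_mulmx det_tr det1 expr2.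
pose D := diag_mx (\row_j (if j == p then \det h else 1)) : 'M[R]_n.
have De q : D *m delta_mx q 0 = (if q == p then \det h else 1) *: (delta_mx q 0 : 'cV[R]_n).
  rewrite /D mul_diag_mx; apply/matrixP => i j; rewrite !mxE.
  by case: (i =P q) => [->//|_]; rewrite !mulr0.
exists D, (\det h); split => //.
- have oD : orthomx D.
    rewrite /orthomx tr_diag_mx mul_diag_mx; apply/matrixP => i j; rewrite !mxE.
    case: (i =P j) => [->|_]; last by rewrite mulr0.
    by case: ifP => _; rewrite !mulr1n -expr2 ?expr1n.
  split; first exact: orthomxM.
  rewrite det_mulmx det_diag (bigD1 p) //= mxE eqxx big1 ?mulr1 -?expr2 //.
  by move=> i ip; rewrite mxE (negbTE ip).
- by rewrite De eqxx.
- by move=> q qp; rewrite De (negbTE qp) scale1r.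
Qed.

(** Gram-Schmidt: a first reflection sends the p-th axis to the direction of x,
    a second one fixes this axis and sends the q-th axis to the direction of the
    component of y orthogonal to x.  The bivector of x and y only sees their
    plane and the area k of their parallelogram, hence the bound on k.  When x
    and y are dependent, k = 0. *)
Lemma wedge_SO p q x y : p != q -> exists h (k : R),
  [/\ SO h, wedge x y = k *: (h *m wedge (delta_mx p 0) (delta_mx q 0) *m h^T)
   & k ^+ 2 <= fdot x x * fdot y y].
Proof.
move=> pq.
have triv : wedge x y = 0 -> exists h (k : R),
  [/\ SO h, wedge x y = k *: (h *m wedge (delta_mx p 0) (delta_mx q 0) *m h^T)
   & k ^+ 2 <= fdot x x * fdot y y].
  move=> ->; exists 1%:M, 0; split; rewrite ?scale0r //.
    by split; rewrite ?trmx1 ?mulmx1 // det1.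
  by rewrite expr0n /= mulr_ge0 // fdot_ge0.
have [x0|x0] := eqVneq x 0.
  by apply: triv; rewrite x0 /wedge mul0mx trmx0 mulmx0 subrr.
have unit_norm (z : 'cV[R]_n) : z != 0 ->
    fdot ((Num.sqrt (fdot z z))^-1 *: z) ((Num.sqrt (fdot z z))^-1 *: z) = 1
    /\ z = Num.sqrt (fdot z z) *: ((Num.sqrt (fdot z z))^-1 *: z).
  move=> z0; have z1 := fdot_gt0 z0.
  have z2 : Num.sqrt (fdot z z) != 0 by rewrite gt_eqF // sqrtr_gt0.
  rewrite fdotZl fdotZr scalerA divff // scale1r mulrA -expr2 exprVn.
  by rewrite sqr_sqrtr ?ltW // mulVf // gt_eqF.
have [u1 xu] := unit_norm x x0.
set a := Num.sqrt _ in xu u1; set u := a^-1 *: x in xu u1; clearbody u.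
have [g [og gp _]] : exists g : 'M[R]_n, [/\ orthomx g, g *m delta_mx p 0 = u &
    forall w, fdot w (delta_mx p 0) = fdot w u -> g *m w = w].
  by apply: householder; rewrite u1 fdot_delta eqxx.
pose y2 := g^T *m y; pose y3 := y2 - y2 p 0 *: delta_mx p 0.
have yy2 : y = g *m y2 by rewrite mulmxA og mul1mx.
have w3 : wedge x y = a *: (g *m wedge (delta_mx p 0) y3 *m g^T).
  rewrite wedgeBr wedgeZr wedgexx scaler0 subr0 wedge_conj gp -yy2.
  by rewrite -wedgeZl -xu.
have [y30|y30] := eqVneq y3 0.
  apply: triv; rewrite w3 y30 -(scale0r (delta_mx p 0)) wedgeZr scale0r.
  by rewrite mulmx0 mul0mx scaler0.
have [v1 yv] := unit_norm y3 y30.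
set b := Num.sqrt _ in yv v1; set v := b^-1 *: y3 in yv v1.
have pv : fdot (delta_mx p 0) v = 0.
  by rewrite /v fdotZr fdot_delta_l !mxE !eqxx mulr1 subrr mulr0.
clearbody v.
have [f [of_ fq fw]] : exists f : 'M[R]_n, [/\ orthomx f, f *m delta_mx q 0 = v &
    forall w, fdot w (delta_mx q 0) = fdot w v -> f *m w = w].
  by apply: householder; rewrite v1 fdot_delta eqxx.
have fp : f *m delta_mx p 0 = delta_mx p 0 :> 'cV_n.
  by apply: fw; rewrite fdot_delta (negbTE pq) pv.
have [D [s [sohD s1 Dp Dq]]] := SO_fix_sign p (orthomxM og of_).
exists (g *m f *m D), (a * b * s); split => //.
- have De : D *m delta_mx q 0 = delta_mx q 0 :> 'cV_n by apply: Dq; rewrite eq_sym.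
  rewrite w3 !wedge_conj {1}yv -!mulmxA Dp De -!scalemxAr fp fq wedgeZl wedgeZr.
  by rewrite !scalerA -[_ * s * s]mulrA -expr2 s1 mulr1.
- rewrite !exprMn s1 mulr1 !sqr_sqrtr ?fdot_ge0 //.
  rewrite ler_wpM2l ?fdot_ge0 //.
  have -> : fdot y y = fdot y2 y2 by rewrite {1 2}yy2 fdot_orthol.
  rewrite /y3 fdotBr !fdotBl !fdotZr !fdotZl fdot_delta eqxx mulr1.
  rewrite (fdotC y2) fdot_delta_l -expr2 subrr subr0 gerBl.
  exact: sqr_ge0.
Qed.

End Wedge.

Lemma plane_mxE (R : realType) n (p q : 'I_n) :
  plane_mx R (p, q) = (Num.sqrt 2)^-1 *: wedge (delta_mx p 0) (delta_mx q 0).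
Proof. by rewrite /plane_mx /wedge !trmx_delta !mul_delta_mx. Qed.


(** Pairing with this vector evaluates at t the polynomial whose coefficients
    are the entries of the other vector. *)
Definition moment_vec (R : pzRingType) n (t : nat) : 'cV[R]_n :=
  \col_b t%:R ^+ b.

(** The value is a polynomial in two variables with coefficients W_ab.  Some
    W_ab has modulus at least 1/n, so for all but fewer than n values of s the
    a-th coefficient of the polynomial in t is not tiny, and then fewer than n
    values of t are bad. *)
Lemma card_bad_frames (R : realFieldType) n M (W : 'M[R]_n) (eta : R) :
  fdot W W = 1 -> 0 <= eta ->
  n%:R * ((2 * M%:R + 3) ^+ n) ^+ 2 * eta < 1 ->
  (#|[set k : 'I_M * 'I_M |
    (`|fdot (moment_vec R n k.1) (W *m moment_vec R n k.2)| <= eta)%R]%SET|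
   <= 2 * n * M)%N.
Proof.
move=> W1 eta0; set X := (_ ^+ n) => Xeta.
have X0 : 0 <= X by rewrite exprn_ge0.
have W0 : W != 0.
  by apply/eqP => W0; move: W1; rewrite W0 fdot0r => /eqP; rewrite eq_sym oner_eq0.
have [a [b]] := fdot_large_entry W0; rewrite W1 => ab.
have n0 : (0 < n%:R :> R) by rewrite ltr0n (leq_ltn_trans _ (ltn_ord a)).
have Wab : X * (X * eta) < `|W a b|.
  have h : 1 <= n%:R * `|W a b|.
    rewrite -(@ler_pXn2r _ 2) ?nnegrE ?mulr_ge0 //.
    by rewrite expr1n exprMn real_normK ?num_real // expr2 -natrM.
  rewrite -(ltr_pM2l n0) (lt_le_trans _ h) //.
  by move: Xeta; rewrite expr2 !mulrA.
have inj : injective (fun t : 'I_M => t : nat) by exact: val_inj.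
have bdd (t : 'I_M) : (t <= M)%N by rewrite ltnW.
pose S1 := [set s : 'I_M | (`|(W *m moment_vec R n s) a 0| <= X * eta)%R]%SET.
have S1n : (#|S1| < n)%N.
  have Xe0 : 0 <= X * eta by rewrite mulr_ge0.
  have := @card_small_values R n M _ _ (fun b => W a b) b (X * eta) inj bdd Xe0 Wab.
  rewrite (_ : [set _ | _]%SET = S1) //; apply/setP => s; rewrite !inE.
  by rewrite mxE; congr (`| _ | <= _); apply: eq_bigr => j _; rewrite mxE.
set A := [set k | _]%SET.
have S2n s : s \notin S1 -> (#|[set t | (t, s) \in A]%SET| <= n)%N.
  rewrite inE -ltNge => h; apply: ltnW.
  have := @card_small_values R n M _ _ (fun c => (W *m moment_vec R n s) c 0) a eta inj bdd eta0 h.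
  rewrite (_ : [set _ | _]%SET = [set t | (t, s) \in A]%SET) //.
  apply/setP => t; rewrite !inE fdotE big_ord1 /=; congr (`| _ | <= _).
  by apply: eq_bigr => j _; rewrite [moment_vec R n t j _]mxE mulrC.
have -> : #|A| = (\sum_(s : 'I_M) #|[set t | (t, s) \in A]%SET|)%N.
  rewrite -sum1_card (eq_bigr (fun k => 1%N)) //.
  rewrite (eq_bigl (fun k : 'I_M * 'I_M => (k.1, k.2) \in A)); last by case.
  rewrite -(pair_big_dep xpredT (fun t s => (t, s) \in A) (fun _ _ => 1%N)) /=.
  rewrite (exchange_big_dep xpredT) //=; apply: eq_bigr => s _.
  by rewrite -sum1_card; apply: eq_bigl => t; rewrite inE.
rewrite (bigID [in S1]) /= mul2n -addnn mulnDl leq_add //.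
  apply: (@leq_trans (\sum_(s in S1) M)).
    by apply: leq_sum => s _; rewrite (leq_trans (max_card _)) ?card_ord.
  by rewrite sum_nat_const leq_mul2r (ltnW S1n) orbT.
apply: (@leq_trans (\sum_(s | s \notin S1) n)); first exact: leq_sum.
rewrite sum_nat_const mulnC leq_mul2l; apply/orP; right.
by rewrite (leq_trans (max_card _)) ?card_ord.
Qed.

(** * The Gram structure of the matrix *)

Section SOgroup.
Variables (R : realType) (n : nat).
Implicit Types A B : 'M[R]_n.

Lemma SO1 : SO (1%:M : 'M[R]_n).
Proof. by split; rewrite ?trmx1 ?mulmx1 ?det1. Qed.

Lemma SOM A B : SO A -> SO B -> SO (A *m B).
Proof.
move=> [oA dA] [oB dB]; split; first exact: orthomxM.
by rewrite det_mulmx dA dB mulr1.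
Qed.

Lemma SOT A : SO A -> SO A^T.
Proof. by move=> [oA dA]; split; rewrite ?trmxK ?det_tr //; exact: orthomx_tr. Qed.

Lemma SO_invmx A : SO A -> invmx A = A^T.
Proof.
move=> [oA _]; have uA := mulmx1_unit oA.
by rewrite -[LHS]mulmx1 -oA mulKmx //; case: uA.
Qed.

End SOgroup.

Section PartialProducts.
Variables (R : realType) (n N : nat).
Implicit Types (P : 'I_N -> 'M[R]_n).

Definition partial_prod P (k : nat) : 'M[R]_n := \prod_(l < N | (l < k)%N) P l.

(** The factors do not commute, so the index range is cut at position a. *)
Lemma partial_prod_split P a b : (a <= N)%N -> (a <= b)%N ->
  partial_prod P b = partial_prod P a *m \prod_(l < N | (a <= l < b)%N) P l.
Proof.
move=> aN ab; rewrite /partial_prod.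
pose F l := if insub l is Some o then P o else 1%:M.
have FE (Q : pred nat) : \prod_(l < N | Q l) P l = \prod_(0 <= l < N | Q l) F l.
  by rewrite big_mkord; apply: eq_bigr => l _; rewrite /F valK.
rewrite (FE (fun l => l < b)%N) (FE (fun l => l < a)%N) (FE (fun l => a <= l < b)%N).
rewrite !(@big_cat_nat _ _ _ a 0%N N) //=.
have -> : \prod_(a <= l < N | (l < a)%N) F l = 1.
  rewrite big_nat_cond big_pred0 // => l; apply: contraTF isT => /andP[/andP[al _]].
  by rewrite ltnNge al.
have -> : \prod_(0 <= l < a | (a <= l < b)%N) F l = 1.
  rewrite big_nat_cond big_pred0 // => l; apply: contraTF isT => /andP[/andP[_ la]].
  by rewrite leqNgt la.
rewrite mulr1 mul1r; congr (_ * _); rewrite big_nat_cond [in RHS]big_nat_cond.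
  apply: eq_bigl => l; case: (ltnP l a) => // la.
  by rewrite (leq_trans la ab) ?andbT.
by apply: eq_bigl => l; case: (leqP a l).
Qed.

Lemma partial_prodS P (k : 'I_N) :
  partial_prod P k.+1 = partial_prod P k *m P k.
Proof.
rewrite (@partial_prod_split _ k) ?(ltnW (ltn_ord k)) //.
by rewrite (big_pred1 k) // => l /=; rewrite ltnS -eqn_leq eq_sym.
Qed.

Lemma prod_SO P (Q : pred 'I_N) : (forall l, SO (P l)) -> SO (\prod_(l < N | Q l) P l).
Proof.
by move=> PSO; apply: (big_ind (fun A => SO A)) => //; [exact: SO1|exact: SOM].
Qed.

(** Coordinatewise map on families: it inserts h after P_i and cancels it at
    once in front of P_(i+1), so that a single partial product changes.  When i
    is the last index, there is nothing to cancel. *)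
Definition twist (i : 'I_N) (h : 'M[R]_n) (l : 'I_N) (X : 'M[R]_n) : 'M[R]_n :=
  if l == i then X *m h else if l == i.+1 :> nat then h^T *m X else X.

Lemma partial_prod_twist P i h k : SO h -> (k <= N)%N ->
  partial_prod (fun l => twist i h l (P l)) k =
  if k == i.+1 then partial_prod P k *m h else partial_prod P k.
Proof.
move=> [oh _]; elim: k => [|k IH] kN; first by rewrite /partial_prod !big_pred0.
have := partial_prodS (fun l => twist i h l (P l)) (Ordinal kN) => /= ->.
have := partial_prodS P (Ordinal kN) => /= ->.
rewrite IH ?(ltnW kN)// eqSS /twist -val_eqE /=.
move: (P _) => X.
have [->|ki] := eqVneq k i; first by rewrite ltn_eqF // mulmxA.
case: eqP => // _.
by rewrite mulmxA -(mulmxA _ h) oh mulmx1.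
Qed.

End PartialProducts.

Section Gram.
Variables (R : realType) (n : nat) (e : 'I_(nb_planes n) -> 'I_n * 'I_n).
Hypothesis e_ord : plane_ordering e.
Local Notation N := (nb_planes n).
Implicit Types P : 'I_N -> 'M[R]_n.

Lemma plane_mx_tr i : (plane_mx R (e i))^T = - plane_mx R (e i).
Proof. by rewrite [e i]surjective_pairing plane_mxE linearZ /= wedge_tr scalerN. Qed.

Lemma fdot_skew_plane (W : 'M[R]_n) i : W^T = - W ->
  fdot W (plane_mx R (e i)) = Num.sqrt 2 * W (e i).1 (e i).2.
Proof.
move=> skW; rewrite [e i]surjective_pairing plane_mxE fdotZr fdot_wedge // fdot_delta_l /=.
rewrite -colE mxE mulrA; congr (_ * _).
have s2 : Num.sqrt 2 != 0 :> R by rewrite gt_eqF // sqrtr_gt0.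
apply: (mulfI s2).
by rewrite mulrA divff // mul1r -expr2 sqr_sqrtr.
Qed.

Lemma e_lt i : ((e i).1 < (e i).2)%N.
Proof. by apply/e_ord.2; exists i. Qed.

Lemma fdot_plane i j : fdot (plane_mx R (e i)) (plane_mx R (e j)) = (i == j)%:R.
Proof.
rewrite fdot_skew_plane ?plane_mx_tr // /plane_mx !mxE mulrA divff ?mul1r; last first.
  by rewrite gt_eqF // sqrtr_gt0.
have -> : (((e j).1 == (e i).2) && ((e j).2 == (e i).1)) = false.
  apply/negP => /andP[/eqP h1 /eqP h2].
  by have := e_lt i; rewrite -h1 -h2 ltnNge ltnW // e_lt.
by rewrite subr0 -xpair_eqE -!surjective_pairing (inj_eq e_ord.1) eq_sym.
Qed.

(** The vectors v_i whose Gram matrix is D_infty when the P_l are rotations: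
    the partial product up to i, common to v_i and v_j for i < j, drops out of
    their inner product and leaves the product of the P_l with i < l <= j. *)
Definition gram_vec P (i : 'I_N) : 'M[R]_n :=
  partial_prod P i.+1 *m plane_mx R (e i) *m (partial_prod P i.+1)^T.

Lemma D_inftyE P : (forall l, SO (P l)) ->
  D_infty e P = \matrix_(i, j) fdot (gram_vec P i) (gram_vec P j).
Proof.
move=> PSO; apply/matrixP => i j; rewrite !mxE.
have up (i' j' : 'I_N) : (i' < j')%N ->
    D_upper e P i' j' = fdot (gram_vec P i') (gram_vec P j').
  move=> ij; rewrite /gram_vec (@partial_prod_split _ _ _ _ i'.+1 j'.+1) //; last exact: ltnW.
  rewrite -/(path_prod P i' j').
  have := prod_SO (fun l : 'I_N => (i' < l <= j')%N) PSO.
  have := prod_SO (fun l : 'I_N => (l < i'.+1)%N) PSO.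
  rewrite -/(path_prod P i' j') -/(partial_prod P i'.+1).
  set Q := partial_prod _ _; set X := path_prod _ _ _ => QSO XSO.
  have -> : Q *m X *m plane_mx R (e j') *m (Q *m X)^T =
      Q *m (X *m plane_mx R (e j') *m X^T) *m Q^T by rewrite trmx_mul !mulmxA.
  rewrite fdot_conj; last by case: QSO.
  by rewrite /D_upper -/X SO_invmx // /fdot plane_mx_tr !mulNmx raddfN /= !mulmxA.
case: ifP => [/eqP ->|/negbT ij].
  rewrite fdot_conj ?fdot_plane ?eqxx //.
  by have [] := prod_SO (fun l : 'I_N => (l < j.+1)%N) PSO.
case: ifP => [|/negbT]; first exact: up.
rewrite -leqNgt leq_eqVlt => /orP[/eqP /val_inj ji|ji]; last by rewrite up // fdotC.
by rewrite ji eqxx in ij.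
Qed.

(** The span of all but one of N vectors has dimension less than N, which is the
    dimension of the space of skew-symmetric matrices. *)
Lemma unit_normal (v : 'I_N -> 'M[R]_n) i : exists W : 'M[R]_n,
  [/\ W^T = - W, fdot W W = 1 & forall j, j != i -> fdot W (v j) = 0].
Proof.
pose A : 'M[R]_N := \matrix_(r, j) (if j == i then 0 else fdot (plane_mx R (e r)) (v j)).
have /det0P[y y0 yA] : \det A == 0.
  by apply/eqP; rewrite (expand_det_col A i) big1 // => r _; rewrite mxE eqxx mul0r.
pose W := \sum_r y 0 r *: plane_mx R (e r).
have Wy r : fdot W (plane_mx R (e r)) = y 0 r.
  rewrite fdot_suml (bigD1 r) //= fdotZl fdot_plane eqxx mulr1 big1 ?addr0 // => s sr.
  by rewrite fdotZl fdot_plane (negbTE sr) mulr0.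
have W0 : W != 0.
  apply: contraNneq y0 => W0; apply/eqP/rowP => r.
  by rewrite -Wy W0 fdotC fdot0r mxE.
have f0 := fdot_gt0 W0.
exists ((Num.sqrt (fdot W W))^-1 *: W); split.
- rewrite linearZ /= -scalerN; congr (_ *: _); rewrite /W linear_sum /= -sumrN.
  by apply: eq_bigr => r _; rewrite linearZ /= plane_mx_tr scalerN.
- by rewrite fdotZl fdotZr mulrA -expr2 exprVn sqr_sqrtr ?ltW // mulVf // gt_eqF.
- move=> j ji; have /matrixP/(_ 0 j) := yA; rewrite !mxE => h.
  rewrite fdotZl [X in _ * X](_ : _ = 0) ?mulr0 // /W fdot_suml -[RHS]h.
  by apply: eq_bigr => r _; rewrite fdotZl mxE (negbTE ji).
Qed.

Lemma gram_vec_twist P i h j : SO h ->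
  gram_vec (fun l => twist i h l (P l)) j =
  if j == i then partial_prod P i.+1 *m (h *m plane_mx R (e i) *m h^T) *m (partial_prod P i.+1)^T
  else gram_vec P j.
Proof.
move=> hSO; rewrite /gram_vec partial_prod_twist // eqSS val_eqE.
by case: eqP => // ->; rewrite trmx_mul !mulmxA.
Qed.

Lemma twist_SO P i h : SO h -> (forall l, SO (P l)) ->
  forall l, SO (twist i h l (P l)).
Proof.
move=> hSO PSO l; rewrite /twist; case: ifP => _; first exact: SOM.
by case: ifP => _ //; apply: SOM => //; exact: SOT.
Qed.

Lemma quad_form_gram (v : 'I_N -> 'M[R]_n) (c : 'rV[R]_N) :
  (c *m (\matrix_(i, j) fdot (v i) (v j)) *m c^T) 0 0 =
  fdot (\sum_j c 0 j *: v j) (\sum_j c 0 j *: v j).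
Proof.
rewrite mxE fdot_sumr; apply: eq_bigr => j _; rewrite !mxE fdotZr fdot_suml.
rewrite mulrC; congr (_ * _).
by apply: eq_bigr => i _; rewrite mxE fdotZl.
Qed.

(** The normal w below depends on the vectors that the twist leaves fixed, so
    the same w serves for all rotations h k.  Cauchy-Schwarz against w turns
    closeness to the span of the others into a small inner product. *)
Lemma card_bad_twists P i M (h : 'I_M * 'I_M -> 'M[R]_n) (B eps eta : R) :
  (forall l, SO (P l)) ->
  (forall k, SO (h k) /\ exists x,
     wedge (moment_vec R n k.1) (moment_vec R n k.2) =
     x *: (h k *m wedge (delta_mx (e i).1 0) (delta_mx (e i).2 0) *m (h k)^T) /\
     x ^+ 2 <= B) ->
  0 <= eps -> 0 <= eta -> B * eps <= eta ^+ 2 ->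
  n%:R * ((2 * M%:R + 3) ^+ n) ^+ 2 * eta < 1 ->
  (#|[set k | `[< exists c : 'rV[R]_N,
      ((c *m D_infty e (fun l => twist i (h k) l (P l)) *m c^T) 0 0
       < eps * c 0 i ^+ 2)%R >]]%SET| <= 2 * n * M)%N.
Proof.
move=> PSO hE eps0 eta0 Beta Xeta.
have [w [skw w1 wv]] := unit_normal (gram_vec P) i.
set Q := partial_prod P i.+1.
have QSO : SO Q by exact: prod_SO.
have oQ := QSO.1.
pose W := Q^T *m w *m Q.
have W1 : fdot W W = 1.
  by rewrite -w1 -(fdot_conj w w (SOT QSO).1) trmxK.
have skW : W^T = - W.
  by rewrite /W !trmx_mul trmxK skw mulmxA mulmxN mulNmx.
apply: leq_trans (card_bad_frames W1 eta0 Xeta).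
apply: subset_leq_card; apply/fintype.subsetP => k; rewrite !inE => -[c].
have [hSO [x [xE xB]]] := hE k.
rewrite D_inftyE; last exact: twist_SO.
rewrite quad_form_gram; set V := (\sum_j _) => Vc.
have ci : 0 < c 0 i ^+ 2.
  rewrite lt_neqAle sqr_ge0 andbT eq_sym; apply: contraTneq Vc => ->.
  by rewrite mulr0 -leNgt fdot_ge0.
set vi := h k *m plane_mx R (e i) *m (h k)^T.
(* the terms of V with j <> i are orthogonal to w *)
have wV : fdot w V = c 0 i * fdot W vi.
  rewrite fdot_sumr (bigD1 i) //= big1 => [|j ji]; last first.
    by rewrite fdotZr gram_vec_twist // (negbTE ji) wv ?mulr0.
  rewrite addr0 fdotZr gram_vec_twist // eqxx -/Q -/vi fdot_mulmxr trmxK fdot_mulmxl.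
  by rewrite mulmxA.
have Wvi : fdot W vi ^+ 2 <= eps.
  have := fdot_CS w V; rewrite w1 mul1r wV exprMn => h1.
  rewrite -(ler_pM2l ci) [_ * eps]mulrC.
  exact: le_trans h1 (ltW Vc).
have xW : x * fdot W vi = Num.sqrt 2 * fdot (moment_vec R n k.1) (W *m moment_vec R n k.2).
  have s2 : Num.sqrt 2 != 0 :> R by rewrite gt_eqF // sqrtr_gt0.
  apply: (mulfI s2); rewrite [RHS]mulrA -expr2 sqr_sqrtr // -fdot_wedge // xE.
  rewrite fdotZr mulrCA -[Num.sqrt 2 * fdot _ _]fdotZr; congr (_ * _); congr fdot.
  rewrite /vi [e i]surjective_pairing plane_mxE -scalemxAr -scalemxAl scalerA divff //.
  by rewrite scale1r.
rewrite -(@ler_pXn2r _ 2) ?nnegrE // real_normK ?num_real //.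
apply: le_trans Beta; apply: le_trans (ler_pM _ _ xB Wvi); rewrite ?sqr_ge0 //.
by rewrite -exprMn xW exprMn sqr_sqrtr // ler_peMl ?sqr_ge0 // ler1n.
Qed.

End Gram.

Lemma moment_vec_norm (R : realType) n M (t : 'I_M) :
  fdot (moment_vec R n t) (moment_vec R n t) <= n%:R * M%:R ^+ (2 * n).
Proof.
have M1 : 1 <= M%:R :> R by rewrite ler1n (leq_trans _ (ltn_ord t)).
rewrite fdotE big_ord1 (_ : n%:R * _ = \sum_(b < n) M%:R ^+ (2 * n)); last first.
  by rewrite sumr_const card_ord mulr_natl.
apply: ler_sum => b _; rewrite mxE -expr2 -exprM mulnC.
apply: (@le_trans _ _ (M%:R ^+ (2 * b))).
  by apply: lerXn2r; rewrite ?nnegrE // ler_nat ltnW.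
by rewrite ler_weXn2l // leq_mul2l ltnW.
Qed.

(** * Smallest singular values as Rayleigh quotients *)

Definition qform (R : realType) N (B : 'M[R]_N) (c : 'rV[R]_N) : R :=
  (c *m B *m c^T) 0 0.

Section Qform.
Variables (R : realType) (N : nat).
Implicit Types (B : 'M[R]_N) (c : 'rV[R]_N).

Lemma qformE B c : qform B c = \sum_j \sum_i c 0 i * B i j * c 0 j.
Proof.
rewrite /qform mxE; apply: eq_bigr => j _; rewrite !mxE mulr_suml.
by apply: eq_bigr => i _.
Qed.

Lemma qform_continuous B : continuous (qform B).
Proof.
have -> : qform B = fun c => \sum_j \sum_i c 0 i * B i j * c 0 j.
  by apply/funext => c; exact: qformE.
apply: continuous_big => [|j _]; first exact: add_continuous.
apply: continuous_big => [|i _]; first exact: add_continuous.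
move=> c.
have coord k : (fun x : 'rV[R]_N => x 0 k) @ c --> c 0 k by exact: coord_continuous.
exact: (cvgM (cvgM (coord i) (cvg_cst (B i j))) (coord j)).
Qed.

Lemma qformB B C c : qform (B - C) c = qform B c - qform C c.
Proof. by rewrite /qform mulmxBr mulmxBl !mxE. Qed.

Lemma qformZ a B c : qform (a *: B) c = a * qform B c.
Proof. by rewrite /qform -scalemxAr -scalemxAl mxE. Qed.

Lemma qformZr a B c : qform B (a *: c) = a ^+ 2 * qform B c.
Proof.
by rewrite /qform linearZ /= -!scalemxAl -scalemxAr scalerA mxE expr2.
Qed.

Lemma qform1 c : qform 1%:M c = fdot c c.
Proof. by rewrite /qform mulmx1 /fdot mxtrace_mulC /mxtrace big_ord1. Qed.

Lemma qform_gram N' (A : 'M[R]_(N', N)) c : qform (A^T *m A) c = fdot (c *m A^T) (c *m A^T).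
Proof.
by rewrite /fdot mxtrace_mulC /mxtrace big_ord1 /qform !trmx_mul trmxK !mulmxA.
Qed.

Lemma compact_sphere : compact [set c : 'rV[R]_N | fdot c c = 1].
Proof.
have cube := @rV_compact _ N (fun=> `[-1, 1 : R]%classic) (fun _ => @segment_compact R _ _).
apply: subclosed_compact cube _.
  have -> : [set c : 'rV[R]_N | fdot c c = 1] = qform 1%:M @^-1` [set 1].
    by apply/seteqP; split => c /=; rewrite qform1.
  by apply: preimage_closed => [c _|]; [exact: qform_continuous|exact: closed_eq].
move=> c /= c1 i; rewrite in_itv /= -ler_norml.
rewrite -(@ler_pXn2r _ 2) ?nnegrE // real_normK ?num_real // expr1n -c1.
exact: sqr_entry_le_fdot.
Qed.

(** The minimum a of the form on the unit sphere is attained at some c0.  Then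
    B - a is positive semidefinite and vanishes at c0, so its first variation
    there, in the direction of its own gradient z, must vanish too. *)
Lemma min_eigenvalue B : (0 < N)%N -> B^T = B ->
  exists2 a, eigenvalue B a & forall c, a * fdot c c <= qform B c.
Proof.
move=> N0 sB.
have [c0 c0S c0min] : exists2 c0, c0 \in [set c : 'rV[R]_N | fdot c c = 1] &
    forall c, c \in [set c : 'rV[R]_N | fdot c c = 1] -> qform B c0 <= qform B c.
  apply: EVT_min_rV; last 2 first.
  - exact: compact_sphere.
  - exact/continuous_subspaceT/qform_continuous.
  exists (delta_mx 0 (Ordinal N0)); rewrite /= fdotE (bigD1 (Ordinal N0)) //= !big_ord1.
  rewrite mxE !eqxx mulr1 big1 ?addr0 // => j j0.
  by rewrite big_ord1 mxE eq_sym (negbTE j0) andbF mulr0.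
move: c0S; rewrite inE /= => c01.
pose a := qform B c0.
have amin c : a * fdot c c <= qform B c.
  have [->|cn0] := eqVneq c 0.
    by rewrite fdot0r mulr0 /qform mul0mx mul0mx mxE.
  have c2 := fdot_gt0 cn0.
  have s2 : Num.sqrt (fdot c c) != 0 by rewrite gt_eqF // sqrtr_gt0.
  have := c0min ((Num.sqrt (fdot c c))^-1 *: c).
  rewrite inE /= fdotZl fdotZr mulrA -expr2 exprVn sqr_sqrtr ?(ltW c2) //.
  rewrite mulVf ?gt_eqF // => /(_ erefl).
  rewrite qformZr exprVn sqr_sqrtr ?(ltW c2) // -/a.
  by rewrite ler_pdivlMl // mulrC.
have aE : qform (B - a%:M) c0 = 0.
  by rewrite qformB -scalemx1 qformZ qform1 c01 mulr1 subrr.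
have pos c : 0 <= qform (B - a%:M) c.
  by rewrite qformB -scalemx1 qformZ qform1 subr_ge0.
set C := B - a%:M in aE pos.
have sC : C^T = C by rewrite /C linearB /= sB tr_scalar_mx.
have CE : C = B - a%:M by [].
clearbody C.
pose z := c0 *m C.
have zC : (z *m C *m c0^T) 0 0 = fdot z z.
  by rewrite -(qform1 z) /qform mulmx1 {3}/z trmx_mul sC mulmxA.
have Cz : (c0 *m C *m z^T) 0 0 = fdot z z by rewrite -qform1 /qform mulmx1.
have expand s : qform C (c0 - s *: z) = s ^+ 2 * qform C z - 2 * s * fdot z z.
  have zT : (c0 - s *: z)^T = c0^T - s *: z^T by rewrite linearB /= linearZ.
  have entry (p q r t : 'M[R]_1) : (p - s *: q - s *: (r - s *: t)) 0 0 =
      p 0 0 - s * q 0 0 - s * (r 0 0 - s * t 0 0) by rewrite !mxE.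
  have -> : qform C (c0 - s *: z) = qform C c0 - s * fdot z z
       - s * (fdot z z - s * qform C z).
    rewrite -{1}Cz -zC /qform -entry zT; congr (fun_of_matrix _ 0 0).
    by rewrite 2!mulmxBl -!scalemxAl !mulmxBr -!scalemxAr.
  by rewrite aE; ring.
have z0 : fdot z z = 0.
  apply/eqP; rewrite eq_le fdot_ge0 andbT leNgt; apply/negP => zz.
  have b0 := pos z; set b := qform C z in b0 expand.
  have b1 : 0 < b + 1 by rewrite ltr_wpDl.
  (* b + 1 rather than b, which may be 0 *)
  have := pos (c0 - (fdot z z / (b + 1)) *: z); rewrite expand.
  set y := fdot z z in zz *.
  have -> : (y / (b + 1)) ^+ 2 * b - 2 * (y / (b + 1)) * y
          = - (y ^+ 2 * ((b + 2) / (b + 1) ^+ 2)).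
    by field; rewrite gt_eqF.
  rewrite oppr_ge0 leNgt mulr_gt0 ?exprn_gt0 // divr_gt0 ?exprn_gt0 //.
  by rewrite ltr_wpDl.
exists a => //; apply/eigenvalueP; exists c0.
  apply/eqP; rewrite -subr_eq0 -mul_mx_scalar -mulmxBr -CE -/z.
  by rewrite -fdot_eq0 z0.
by apply: contra_eqN c01 => /eqP ->; rewrite fdot0r eq_sym oner_eq0.
Qed.

(** A countable family of open conditions on A, each of which says that a
    quadratic form takes a negative value; this is the form in which
    measurability can be proved. *)
Lemma smallest_singular_value_le (A : 'M[R]_N) (eps : R) : (0 < N)%N ->
  0 <= eps ->
  smallest_singular_value A <= eps <->
  forall k, exists c, qform (A^T *m A - ((eps + k.+1%:R^-1) ^+ 2)%:M) c < 0.
Proof.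
move=> N0 eps0.
have qE b c : qform (A^T *m A - (b ^+ 2)%:M) c = qform (A^T *m A) c - b ^+ 2 * fdot c c.
  by rewrite qformB -scalemx1 qformZ qform1.
have sA : (A^T *m A)^T = A^T *m A by rewrite trmx_mul trmxK.
have [a ea amin] := min_eigenvalue N0 sA.
have aS : singular_values A (Num.sqrt a) by exists a.
have lbS : has_lbound (singular_values A).
  by exists 0 => _ [x _ <-]; exact: sqrtr_ge0.
have b0 k : 0 < eps + k.+1%:R^-1 :> R by rewrite ltr_wpDl // invr_gt0.
split => [sle k|h].
  have : inf (singular_values A) < eps + k.+1%:R^-1.
    by rewrite (le_lt_trans sle) // ltrDl invr_gt0.
  move=> /inf_lt[|_ [x /eigenvalueP[v vx v0] <-] xlt]; first by exists (Num.sqrt a).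
  exists v; rewrite qE.
  have -> : qform (A^T *m A) v = x * fdot v v.
    by rewrite /qform vx -scalemxAl mxE -qform1 /qform mulmx1.
  rewrite -mulrBl pmulr_llt0 ?fdot_gt0 // subr_lt0.
  have [x0|x0] := ltP x 0; first by rewrite (lt_le_trans x0) // sqr_ge0.
  by rewrite -[x in x < _]sqr_sqrtr // ltr_pXn2r ?nnegrE ?sqrtr_ge0 // ltW.
rewrite leNgt; apply/negP => /ltr_add_invr[k].
have [c] := h k; rewrite qE subr_lt0 => qc.
have c0 : 0 < fdot c c.
  apply: fdot_gt0; apply: contraTneq qc => ->.
  by rewrite fdot0r mulr0 /qform !mul0mx mxE ltxx.
have := le_lt_trans (amin c) qc; rewrite ltr_pM2r // => ab.
apply/negP; rewrite -leNgt (le_trans (ge_inf lbS aS)) //.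
rewrite -(ger0_norm (ltW (b0 k))) -sqrtr_sqr ler_sqrt ?sqr_ge0 //.
exact: ltW.
Qed.

End Qform.

(** * Measurable matrix-valued maps *)

(** Entrywise measurability, which also makes sense for rectangular matrices;
    for square ones it amounts to Borel measurability. *)
Definition mx_measurable d (X : measurableType d) (R : realType) m n
    (F : X -> 'M[R]_(m, n)) :=
  forall i j, measurable_fun [set: X] (fun x => F x i j).

Section MxMeasurable.
Variables (d : measure_display) (X : measurableType d) (R : realType).

Lemma measurable_invr (f : X -> R) :
  measurable_fun setT f -> measurable_fun setT (fun x => (f x)^-1).
Proof.
move=> mf.
(* the power -1 is the inverse on nonnegative numbers only, hence the square *)
have -> : (fun x => (f x)^-1) = (fun x => f x * (f x ^+ 2) `^ (-1)).
  apply/funext => x; rewrite powR_inv1 ?sqr_ge0 //.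
  have [->|f0] := eqVneq (f x) 0; first by rewrite invr0 mul0r.
  by rewrite expr2 invfM mulrA divff // mul1r.
apply: measurable_funM => //.
have m2 : measurable_fun setT (fun x => f x ^+ 2) by exact: measurable_funX.
exact: (measurableT_comp (measurable_powR _) m2).
Qed.

Lemma measurable_lt0 (f : X -> R) :
  measurable_fun setT f -> measurable [set x | f x < 0].
Proof.
move=> /(_ measurableT _ (measurable_itv `]-oo, 0[)); rewrite setTI.
by congr measurable; apply/seteqP; split => x /=; rewrite in_itv.
Qed.

Lemma mx_measurable_cst m n (A : 'M[R]_(m, n)) : mx_measurable (fun _ : X => A).
Proof. by move=> i j; exact: measurable_cst. Qed.

Lemma mx_measurableM m n p (F : X -> 'M[R]_(m, n)) (G : X -> 'M[R]_(n, p)) :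
  mx_measurable F -> mx_measurable G -> mx_measurable (fun x => F x *m G x).
Proof.
move=> mF mG i j; under eq_fun do rewrite mxE.
by apply: measurable_sum => k; exact: measurable_funM.
Qed.

Lemma mx_measurableB m n (F G : X -> 'M[R]_(m, n)) :
  mx_measurable F -> mx_measurable G -> mx_measurable (fun x => F x - G x).
Proof.
move=> mF mG i j; under eq_fun do rewrite !mxE.
exact: measurable_funB.
Qed.

Lemma mx_measurableT m n (F : X -> 'M[R]_(m, n)) :
  mx_measurable F -> mx_measurable (fun x => (F x)^T).
Proof. by move=> mF i j; under eq_fun do rewrite mxE; exact: mF. Qed.

Lemma mx_measurable_prod n (I : Type) (s : seq I) (Q : pred I) (F : I -> X -> 'M[R]_n) :
  (forall i, mx_measurable (F i)) -> mx_measurable (fun x => \prod_(i <- s | Q i) F i x).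
Proof.
move=> mF; elim: s => [|a s IH].
  move=> i j; under eq_fun do rewrite big_nil.
  exact: measurable_cst.
rewrite (_ : (fun x => _) = fun x => if Q a then F a x *m \prod_(i <- s | Q i) F i x
  else \prod_(i <- s | Q i) F i x); last by apply/funext => x; rewrite big_cons.
by case: (Q a) => //; exact: mx_measurableM.
Qed.

Lemma measurable_det n (F : X -> 'M[R]_n) :
  mx_measurable F -> measurable_fun setT (fun x => \det (F x)).
Proof.
move=> mF; apply: measurable_sum => s; apply: measurable_funM => //.
by apply: measurable_prod => i _; exact: mF.
Qed.

Lemma measurable_mxtrace n (F : X -> 'M[R]_n) :
  mx_measurable F -> measurable_fun setT (fun x => \tr (F x)).
Proof. by move=> mF; apply: measurable_sum => i; exact: mF. Qed.

Lemma mx_measurable_invmx n (F : X -> 'M[R]_n) :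
  mx_measurable F -> mx_measurable (fun x => invmx (F x)).
Proof.
move=> mF i j.
have -> : (fun x => invmx (F x) i j) =
    (fun x => if \det (F x) == 0 then F x i j
              else (\det (F x))^-1 * ((-1) ^+ (j + i) * \det (row' j (col' i (F x))))).
  apply/funext => x; rewrite /invmx unitmxE unitfE; case: eqP => //= _.
  by rewrite !mxE.
have mdet := measurable_det mF.
apply: measurable_fun_ifT => //.
  by apply: measurable_fun_eqr => //; exact: measurable_cst.
apply: measurable_funM; first exact: measurable_invr.
apply: measurable_funM; first exact: measurable_cst.
apply: measurable_det => a b; under eq_fun do rewrite !mxE.
exact: mF.
Qed.

(** Negativity is an open condition on c, so c can be taken rational, which
    leaves a countable union. *)
Lemma measurable_exists_qform_lt0 N (B : X -> 'M[R]_N) :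
  mx_measurable B -> measurable [set x | exists c, qform (B x) c < 0].
Proof.
move=> mB.
have -> : [set x | exists c, qform (B x) c < 0] =
    \bigcup_(c in [set: 'rV[rat]_N]) [set x | qform (B x) (map_mx ratr c) < 0].
  apply/seteqP; split => [x /= [c qc]|x [c _ /= qc]]; last by exists (map_mx ratr c).
  have : nbhs c (qform (B x) @^-1` [set y | y < 0]).
    apply: (@qform_continuous _ _ (B x) c).
    by apply: open_nbhs_nbhs; split => //; exact: open_lt.
  move=> /nbhs_ballP[r /= r0 cr].
  have /choice[q qE] : forall j, exists q : rat, ratr q \in `](c 0 j - r), (c 0 j + r)[.
    move=> j; apply: rat_in_itvoo.
    by rewrite ltrBlDr -addrA ltrDl addr_gt0.
  exists (\row_j q j) => //=; apply: cr.
  split => // i j; rewrite ord1 /ball /= /ball_ !mxE.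
  have := qE j; rewrite in_itv /= => /andP[q1 q2].
  by rewrite distrC ltr_distl q1 q2.
apply: countable_bigcupT_measurable => // c.
have mq : measurable_fun setT (fun x => qform (B x) (map_mx ratr c)).
  set v : 'rV[R]_N := map_mx _ _.
  exact: (mx_measurableM (mx_measurableM (mx_measurable_cst v) mB)
    (mx_measurable_cst v^T)).
exact: measurable_lt0.
Qed.

End MxMeasurable.

(** * Borel sets of matrices and Haar measure *)

Section BorelMatrices.
Variables (R : realType) (n : nat).

Lemma mx_measurable_borel_id :
  mx_measurable (fun A : mx_borel R n => A : 'M[R]_n).
Proof.
move=> i j; apply: (measurability _ (RGenOpens.measurableE R)).
move=> _ [_ [x [y ->]] <-]; rewrite setTI; apply: sub_sigma_algebra.
have := @continuousP _ _ (fun A : 'M[R]_n => A i j).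
move=> [/(_ (@coord_continuous _ _ _ i j)) h _]; apply: h.
exact: interval_open.
Qed.

Lemma mx_measurable_comp d (X : measurableType d) (F : X -> mx_borel R n) :
  measurable_fun setT F -> mx_measurable (fun x => F x : 'M[R]_n).
Proof. by move=> mF i j; apply: (measurableT_comp (mx_measurable_borel_id i j) mF). Qed.

(** An open set is the union of the rational boxes that it contains. *)
Lemma mx_measurable_borel d (X : measurableType d) (F : X -> 'M[R]_n) :
  mx_measurable F -> measurable_fun setT (F : X -> mx_borel R n).
Proof.
move=> mF; apply: (@measurability _ _ X (mx_borel R n) setT F (@open 'M[R]_n)) => // _ [U oU <-]; rewrite setTI.
pose box (cr : 'M[rat]_n * nat) : set 'M[R]_n :=
  [set A | forall i j, `|ratr (cr.1 i j) - A i j| < cr.2.+1%:R^-1].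
have -> : F @^-1` U = \bigcup_(cr in [set: 'M[rat]_n * nat])
    (if pselect (box cr `<=` U) then F @^-1` (box cr) else set0).
  apply/seteqP; split => [x /= Ux|x [cr _]]; last first.
    by case: pselect => // h /=; exact: h.
  have : nbhs (F x) U by exact: open_nbhs_nbhs.
  move=> /nbhs_ballP[r /= r0 rU].
  have [k] := ltr_add_invr (divr_gt0 r0 (ltr0Sn _ 1)); rewrite add0r => kr.
  have /choice[q qE] : forall ij : 'I_n * 'I_n, exists q : rat,
      ratr q \in `](F x ij.1 ij.2 - k.+1%:R^-1), (F x ij.1 ij.2 + k.+1%:R^-1)[.
    by move=> ij; apply: rat_in_itvoo; rewrite ltrBlDr -addrA ltrDl addr_gt0 ?invr_gt0.
  have xb : box (\matrix_(i, j) q (i, j), k) (F x).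
    move=> i j /=; rewrite mxE; have := qE (i, j); rewrite in_itv /= => /andP[q1 q2].
    by rewrite ltr_distl q1 q2.
  exists (\matrix_(i, j) q (i, j), k) => //; case: pselect => //= h; exfalso; apply: h.
  move=> A Ab; apply: rU; split => // i j; rewrite /ball /= /ball_.
  have := xb i j; have := Ab i j; set c : R := ratr _ => /= h1 h2.
  rewrite (_ : F x i j - A i j = (c - A i j) - (c - F x i j)); last by ring.
  rewrite (le_lt_trans (ler_normB _ _)) // (lt_trans (ltrD h1 h2)) //.
  by rewrite [ltRHS]splitr ltrD.
apply: countable_bigcupT_measurable => // -[c k].
case: pselect => //= _.
have -> : F @^-1` box (c, k) = \bigcap_(ij in [set: 'I_n * 'I_n])
    [set x | `|ratr (c ij.1 ij.2) - F x ij.1 ij.2| - k.+1%:R^-1 < 0].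
  apply/seteqP; split => x /= h.
    by move=> [i j] _ /=; rewrite subr_lt0; exact: h.
  by move=> i j; have := h (i, j) I; rewrite /= subr_lt0.
apply: fin_bigcap_measurable => // -[i j] _ /=.
apply: measurable_lt0; apply: measurable_funB => //.
apply: measurableT_comp => //; apply: measurable_funB => //; exact: mF.
Qed.

Lemma measurable_SO : measurable (@SO R n : set (mx_borel R n)).
Proof.
have -> : (@SO R n : set (mx_borel R n)) =
    (\bigcap_(ij in [set: 'I_n * 'I_n])
       ((fun A : mx_borel R n => ((A : 'M[R]_n) *m (A : 'M[R]_n)^T) ij.1 ij.2)
         @^-1` [set (1%:M : 'M[R]_n) ij.1 ij.2]))
    `&` (fun A : mx_borel R n => \det (A : 'M[R]_n)) @^-1` [set 1].
  apply/seteqP; split => A /=.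
    by move=> [oA dA]; split => // -[i j] _ /=; rewrite oA.
  by move=> [h dA]; split => //; apply/matrixP => i j; exact: (h (i, j) I).
apply: measurableI.
  apply: fin_bigcap_measurable => // -[i j] _ /=.
  rewrite -[X in measurable X]setTI.
  have h := mx_measurableM mx_measurable_borel_id (mx_measurableT mx_measurable_borel_id).
  exact: (h i j measurableT _ (measurable_set1 _)).
rewrite -[X in measurable X]setTI.
exact: (measurable_det mx_measurable_borel_id measurableT (measurable_set1 _)).
Qed.

End BorelMatrices.

Section Haar.
Variables (R : realType) (n : nat) (mu : probability (mx_borel R n) R).
Hypothesis haar : normalized_haar_SO mu.
Local Notation M := (mx_borel R n).

Lemma measurable_preimage_mulmx (g h : 'M[R]_n) (B : set M) : measurable B ->
  measurable ([set A | B (g *m (A : 'M[R]_n) *m h)] : set M).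
Proof.
move=> mB; rewrite -[X in measurable X]setTI.
have := mx_measurableM (mx_measurableM (mx_measurable_cst g) (@mx_measurable_borel_id R n)) (mx_measurable_cst h).
by move=> /mx_measurable_borel/(_ measurableT _ mB).
Qed.

Lemma measurable_preimage_trmx (B : set M) : measurable B ->
  measurable ([set A | B ((A : 'M[R]_n)^T)] : set M).
Proof.
move=> mB; rewrite -[X in measurable X]setTI.
have := mx_measurableT (@mx_measurable_borel_id R n).
by move=> /mx_measurable_borel/(_ measurableT _ mB).
Qed.

Lemma haar_left (g : 'M[R]_n) (B : set M) : SO g -> measurable B ->
  mu [set A | B (g *m (A : 'M[R]_n))] = mu B.
Proof.
move=> gSO mB; rewrite -[RHS](haar.2 _ _ (SOT gSO) mB).
have [og _] := gSO; have go := orthomx_tr og.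
congr (mu _); apply/seteqP; split => A /=.
  by move=> BA; exists (g *m A) => //; rewrite mulmxA go mul1mx.
by move=> [C BC <-]; rewrite mulmxA og mul1mx.
Qed.

Lemma haar_integral_cst (f : M -> \bar R) (r : \bar R) :
  measurable_fun setT f -> (forall A, (0 <= f A)%E) -> (0 <= r)%E ->
  (forall A, SO (A : 'M[R]_n) -> f A = r) -> (\int[mu]_A f A = r)%E.
Proof.
move=> mf f0 r0 fr.
have -> : (\int[mu]_A f A = \int[mu]_A cst r A)%E.
  apply: ge0_ae_eq_integral => //.
  exists (~` (@SO R n : set M)); split.
  - exact: measurableC (@measurable_SO R n).
  - by have := probability_setC mu (@measurable_SO R n); rewrite haar.1 subee.
  - by move=> A /= h; apply: contra_not h => SA _; exact: fr.
rewrite -[RHS]mule1 -[in RHS](probability_setT mu).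
exact: integral_cst.
Qed.

(** Invariance under inversion.  Integrate the indicator of X^T Y in B over
    independent X and Y: for fixed X in SO(n) left invariance in Y gives mu B,
    and for fixed Y, as X^T Y = (Y^T X)^T, left invariance in X gives the
    measure of the transposes. *)
Lemma haar_trmx (B : set M) : measurable B ->
  mu [set A | B ((A : 'M[R]_n)^T)] = mu B.
Proof.
move=> mB.
pose S : set (M * M) := [set AC | B ((AC.1 : 'M[R]_n)^T *m (AC.2 : 'M[R]_n))].
have mS : measurable S.
  rewrite -[S]setTI.
  have m1 := mx_measurableT (mx_measurable_comp (@measurable_fst _ _ M M)).
  have m2 := mx_measurable_comp (@measurable_snd _ _ M M).
  exact: (mx_measurable_borel (mx_measurableM m1 m2) measurableT mB).
have mT := measurable_preimage_trmx mB.
have E1 : (mu \x mu)%E S = mu B.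
  apply: haar_integral_cst => //.
    exact: measurable_fun_xsection.
  move=> A SA; rewrite /= -(haar_left (SOT SA) mB); congr (mu _).
  by apply/seteqP; split => C; rewrite /xsection /= inE.
have E2 : (mu \x^ mu)%E S = mu [set A | B ((A : 'M[R]_n)^T)].
  apply: haar_integral_cst => //.
    exact: measurable_fun_ysection.
  move=> A SA; rewrite /= -(haar_left (SOT SA) mT); congr (mu _).
  by apply/seteqP; split => C; rewrite /ysection /= inE trmx_mul trmxK.
rewrite -E1 -E2; apply/esym/product_measure_unique => // A1 A2 mA1 mA2.
exact: product_measure2E.
Qed.

(** Right translations are left translations conjugated by transposition. *)
Lemma haar_right (g : 'M[R]_n) (B : set M) : SO g -> measurable B ->
  mu [set A | B ((A : 'M[R]_n) *m g)] = mu B.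
Proof.
move=> gSO mB; have mT := measurable_preimage_trmx mB.
rewrite -[RHS]haar_trmx // -(haar_left (SOT gSO) mT) -haar_trmx.
  by congr (mu _); apply/seteqP; split => A /=; rewrite trmx_mul !trmxK.
have := measurable_preimage_mulmx 1%:M g mB; congr (measurable _).
by apply/seteqP; split => A /=; rewrite mul1mx.
Qed.

End Haar.

(** * Laws of independent families *)

(** A name for the function type, to carry the sigma-algebra generated by the
    measurable boxes. *)
Definition mx_family (R : realType) (n N : nat) : Type := 'I_N -> 'M[R]_n.

HB.instance Definition _ R n N := gen_eqMixin (@mx_family R n N).
HB.instance Definition _ R n N := gen_choiceMixin (@mx_family R n N).
HB.instance Definition _ R n N := isPointed.Build (@mx_family R n N) (fun=> 0).

Definition boxes (R : realType) (n N : nat) : set (set (mx_family R n N)) :=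
  [set E | exists2 B : 'I_N -> set (mx_borel R n),
     forall l, measurable (B l) & E = [set P | forall l, B l (P l)]].

Definition mx_family_borel (R : realType) (n N : nat) :
    measurableType (@boxes R n N).-sigma :=
  g_sigma_algebraType (@boxes R n N).

Lemma mx_measurable_coord (R : realType) n N (l : 'I_N) :
  mx_measurable (fun P : mx_family_borel R n N => (P : mx_family R n N) l).
Proof.
apply: mx_measurable_comp => _ B mB; rewrite setTI; apply: sub_sigma_algebra.
exists (fun k => if k == l then B else setT) => [k|]; first by case: ifP.
apply/seteqP; split => P /= h; last by have := h l; rewrite eqxx.
by move=> k; case: eqP => // ->.
Qed.

Lemma boxes_setI R n N : setI_closed (@boxes R n N).
Proof.
move=> _ _ [B mB ->] [C mC ->]; exists (fun l => B l `&` C l).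
  by move=> l; exact: measurableI.
apply/seteqP; split => P /=; first by move=> [h1 h2] l; split.
by move=> h; split => l; case: (h l).
Qed.

Section Law.
Variables (R : realType) (n N : nat).
Variables (d : measure_display) (T : measurableType d) (Pr : probability T R).
Variables (mu : probability (mx_borel R n) R).
Variable P : 'I_N -> {RV Pr >-> mx_borel R n}.
Hypothesis P_indep : mutually_independent P.
Hypothesis P_ident : identically_distributed P mu.

Definition family (w : T) : mx_family R n N := fun l => P l w.

Lemma measurable_family_map (phi : 'I_N -> mx_borel R n -> mx_borel R n) :
  (forall l, measurable_fun setT (phi l)) ->
  measurable_fun setT ((fun w l => phi l (P l w)) : T -> mx_family_borel R n N).
Proof.
move=> mphi.
apply: (@measurability _ _ T (mx_family_borel R n N) setT _ (@boxes R n N)) => //.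
move=> _ [_ [B mB ->] <-]; rewrite setTI.
have -> : (fun w l => phi l (P l w)) @^-1` [set Q | forall l, B l (Q l)] =
    \bigcap_(l in [set: 'I_N]) ((phi l \o P l) @^-1` (B l)).
  by apply/seteqP; split => w /= h; [move=> l _; exact: h|move=> l; exact: (h l I)].
apply: fin_bigcap_measurable => // l _; rewrite -[X in measurable X]setTI.
by apply: (measurableT_comp (mphi l)) => //.
Qed.

Lemma prob_box (B : 'I_N -> set (mx_borel R n)) : (forall l, measurable (B l)) ->
  Pr [set w | forall l, B l (P l w)] = (\prod_l mu (B l))%E.
Proof.
move=> mB; have := P_indep (J := [set: 'I_N]%SET) (fun i _ => mB i).
rewrite (_ : \bigcap_(i in _) _ = [set w | forall l, B l (P l w)]); last first.
  apply/seteqP; split => w /= h; first by move=> l; apply: h; rewrite /= inE.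
  by move=> l _; exact: h.
move=> ->; rewrite (eq_bigl xpredT); last by move=> l; rewrite inE.
by apply: eq_bigr => l _; rewrite -(P_ident l (mB l)).
Qed.

(** On a box both probabilities are the same product, by independence; boxes are
    stable under intersection, so Dynkin's theorem extends the equality. *)
Lemma law_invariant (phi : 'I_N -> mx_borel R n -> mx_borel R n) :
  (forall l, measurable_fun setT (phi l)) ->
  (forall l B, measurable B -> mu (phi l @^-1` B) = mu B) ->
  forall E : set (mx_family_borel R n N), measurable E ->
  Pr [set w | E (fun l => phi l (P l w))] = Pr [set w | E (family w)].
Proof.
move=> mphi muphi.
have mF (psi : 'I_N -> mx_borel R n -> mx_borel R n) (S : set (mx_family_borel R n N)) :
    (forall l, measurable_fun setT (psi l)) -> measurable S ->
    measurable [set w | S (fun l => psi l (P l w))].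
  move=> mpsi mS; rewrite -[X in measurable X]setTI.
  exact: (measurable_family_map mpsi measurableT mS).
have mG (S : set (mx_family_borel R n N)) : measurable S ->
    measurable [set w | S (family w)].
  by move=> mS; apply: (mF (fun _ => id)) => // l; exact: measurable_id.
have mP S := mF phi S mphi.
apply: (@dynkin_induction _ (mx_family_borel R n N) (@boxes R n N)
  (fun E => Pr [set w | E (fun l => phi l (P l w))] = Pr [set w | E (family w)])).
- by [].
- exact: boxes_setI.
- by congr (Pr _); apply/seteqP; split.
- move=> _ [B mB ->] /=; rewrite (prob_box mB).
  have mphiB l : measurable (phi l @^-1` B l).
    by rewrite -[X in measurable X]setTI; exact: mphi.
  by rewrite (prob_box mphiB); apply: eq_bigr => l _; exact: muphi.
- move=> S mS h; have := congr1 (fun x => 1 - x)%E h.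
  by rewrite -!probability_setC; [|exact: mG|exact: mP].
- move=> F mFm tF h.
  have E (G : T -> mx_family R n N) : (forall k, measurable [set w | F k (G w)]) ->
      Pr [set w | (\bigcup_k F k) (G w)] = (\sum_(0 <= k <oo) Pr [set w | F k (G w)])%E.
    move=> mFG; have := @measure_bigcup _ _ _ Pr setT (fun k => [set w | F k (G w)]).
    rewrite (_ : \bigcup_(k in _) _ = [set w | (\bigcup_k F k) (G w)]) //; move=> ->.
    - by apply: eq_eseriesl => k; rewrite in_setT.
    - by move=> k _; exact: mFG.
    - by move=> i j _ _ [w [/= Fi Fj]]; apply: (tF i j I I); exists (G w).
  rewrite (E (fun w l => phi l (P l w))) ?(E family) //; last 2 first.
  + by move=> k; exact: mG.
  + by move=> k; exact: mP.
  by apply: eq_eseriesr => k _.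
Qed.

Lemma prob_SO : mu (@SO R n : set (mx_borel R n)) = 1%E ->
  Pr [set w | forall l, SO (P l w : 'M[R]_n)] = 1%E.
Proof.
move=> mu1; rewrite (prob_box (fun l => @measurable_SO R n)).
by rewrite big1.
Qed.

End Law.

(** Integrate the number of events that occur. *)
Lemma prob_le_of_overlap d (T : measurableType d) (R : realType)
    (Pr : probability T R) (K : finType) (A : K -> set T) (L : nat) (p : \bar R) :
  (forall k, measurable (A k)) -> (forall k, Pr (A k) = p) ->
  (forall w, (#|[set k | `[< A k w >]]%SET| <= L)%N) ->
  (#|K|%:R%:E * p <= L%:R%:E)%E.
Proof.
move=> mA Ap AL.
have [K0|/card_gt0P[k0 _]] := posnP #|K|; first by rewrite K0 mul0e lee_fin.
have pfin : p \is a fin_num by rewrite -(Ap k0); exact: fin_num_measure.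
have -> : (#|K|%:R%:E * p = \sum_(k : K) \int[Pr]_w (\1_(A k) w)%:E)%E.
  have ip k : (\int[Pr]_w (\1_(A k) w)%:E)%E = p.
    by rewrite -(Ap k) -[in RHS](setIT (A k)); exact: integral_indic.
  under eq_bigr do rewrite ip.
  by rewrite -(fineK pfin) sumEFin sumr_const -EFinM mulr_natl.
have mi k : measurable_fun setT (fun w => (\1_(A k) w)%:E : \bar R).
  exact/measurable_EFinP/measurable_indic.
rewrite -ge0_integral_sum //.
apply: (@le_trans _ _ (\int[Pr]_w cst L%:R%:E w)%E); last first.
  rewrite -[leRHS]mule1 -[in leRHS](probability_setT Pr) le_eqVlt; apply/orP; left.
  by apply/eqP; exact: integral_cst.
apply: ge0_le_integral => //.
- by move=> w _; apply: sume_ge0 => k _; rewrite lee_fin.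
- by apply: emeasurable_sum => k; exact: mi.
- move=> w _; rewrite /= sumEFin lee_fin.
  rewrite (_ : \sum_(k : K) _ = #|[set k | `[< A k w >]]%SET|%:R).
    by rewrite ler_nat.
  rewrite -sum1_card natr_sum [RHS]big_mkcond; apply: eq_bigr => k _ /=.
  by rewrite indicE inE /mem; case: asboolP => h; [rewrite mem_set|rewrite memNset].
Qed.

(** * Probability of a small singular value *)

Lemma probability_setI_full d (T : measurableType d) (R : realType)
    (Pr : probability T R) (A S : set T) :
  measurable A -> measurable S -> Pr S = 1%E -> Pr (A `&` S) = Pr A.
Proof.
move=> mA mS S1; have mC := measurableC mS.
have C0 : Pr (~` S) = 0%E by rewrite probability_setC // S1 subee.
apply/eqP; rewrite eq_le; apply/andP; split.
  by apply: le_measure; rewrite ?inE //; exact: measurableI.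
rewrite -[leRHS]adde0 -[in leRHS]C0.
apply: (@le_trans _ _ (Pr ((A `&` S) `|` ~` S))).
  apply: le_measure; rewrite ?inE //.
    by apply: measurableU => //; exact: measurableI.
  by move=> w Aw; have [Sw|nSw] := pselect (S w); [left|right].
by apply: measureU2 => //; exact: measurableI.
Qed.

Lemma prob_union_bound d (T : measurableType d) (R : realType)
    (Pr : probability T R) (I : finType) (A : I -> set T) (E : set T) :
  (forall i, measurable (A i)) -> measurable E ->
  (forall w, E w -> exists i, A i w) -> (Pr E <= \sum_i Pr (A i))%E.
Proof.
move=> mA mE EA.
have mU s : measurable (\big[setU/set0]_(i <- s) A i).
  by apply: bigsetU_measurable => i _; exact: mA.
apply: (@le_trans _ _ (Pr (\big[setU/set0]_(i <- index_enum I) A i))).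
  apply: le_measure; rewrite ?inE // => w /EA[i Ai].
  by rewrite (bigD1_seq i) ?mem_index_enum ?index_enum_uniq //=; left.
elim: (index_enum I) => [|i s IH]; first by rewrite !big_nil measure0.
rewrite !big_cons (le_trans (measureU2 _ _ _)) //.
exact: leeD.
Qed.

Section Events.
Variables (R : realType) (n : nat) (e : 'I_(nb_planes n) -> 'I_n * 'I_n).
Local Notation N := (nb_planes n).

Lemma mx_measurable_D_infty :
  mx_measurable (fun P : mx_family_borel R n N => D_infty e P).
Proof.
have mup i j : measurable_fun setT (fun P : mx_family_borel R n N => D_upper e P i j).
  have mpp : mx_measurable (fun P : mx_family_borel R n N => path_prod P i j).
    by apply: mx_measurable_prod => l; exact: mx_measurable_coord.
  apply: measurable_funN; apply: measurable_mxtrace.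
  apply: mx_measurableM (mx_measurable_invmx mpp).
  apply: mx_measurableM (mx_measurable_cst _).
  exact: mx_measurableM (mx_measurable_cst _) mpp.
move=> i j; under eq_fun do rewrite mxE.
case: (i == j); first exact: measurable_cst.
by case: (i < j)%N; exact: mup.
Qed.

(** When D_infty is the Gram matrix of v_1, ..., v_N, the left-hand side is the
    squared norm of the combination of the v_j with coefficients c; dividing by
    c_i, the event says that v_i is at distance less than sqrt eps from the span
    of the others. *)
Definition near_span (eps : R) (i : 'I_N) : set (mx_family_borel R n N) :=
  [set P | exists c, qform (D_infty e P) c < eps * c 0 i ^+ 2].

Lemma measurable_near_span eps i : measurable (near_span eps i).
Proof.
have -> : near_span eps i =
    [set P | exists c, qform (D_infty e P - eps *: delta_mx i i) c < 0].
  have E P c : (qform (D_infty e P - eps *: delta_mx i i) c < 0) =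
      (qform (D_infty e P) c < eps * c 0 i ^+ 2).
    rewrite qformB qformZ subr_lt0; congr (_ < _ * _).
    rewrite qformE (bigD1 i) //= [X in _ + X]big1 => [|j ji]; last first.
      by rewrite big1 // => k _; rewrite mxE (negbTE ji) andbF mulr0 mul0r.
    rewrite addr0 (bigD1 i) //= big1 => [|k ki]; last first.
      by rewrite mxE (negbTE ki) mulr0 mul0r.
    by rewrite addr0 mxE !eqxx mulr1 expr2.
  by apply/seteqP; split => P [c qc]; exists c; move: qc; rewrite E.
apply: measurable_exists_qform_lt0; apply: mx_measurableB.
  exact: mx_measurable_D_infty.
exact: mx_measurable_cst.
Qed.

Lemma measurable_small_singular_value eps : (0 < N)%N -> 0 <= eps ->
  measurable ([set P | smallest_singular_value (D_infty e P) <= eps]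
    : set (mx_family_borel R n N)).
Proof.
move=> N0 eps0.
have -> : ([set P | smallest_singular_value (D_infty e P) <= eps] : set (mx_family_borel R n N)) =
  \bigcap_k [set P | exists c, qform ((D_infty e P)^T *m D_infty e P
               - ((eps + k.+1%:R^-1) ^+ 2)%:M) c < 0].
  apply/seteqP; split => P /=.
    by move/(smallest_singular_value_le _ N0 eps0) => h k _; exact: h.
  by move=> h; apply/(smallest_singular_value_le _ N0 eps0) => k; exact: (h k I).
apply: bigcapT_measurable => k; apply: measurable_exists_qform_lt0.
apply: mx_measurableB; last exact: mx_measurable_cst.
apply: mx_measurableM; last exact: mx_measurable_D_infty.
by apply: mx_measurableT; exact: mx_measurable_D_infty.
Qed.

Hypothesis e_ord : plane_ordering e.

(** Take i to be the index of the largest coordinate of a vector c for which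
    D c is short: its square is at least the squared norm of c divided by N. *)
Lemma near_span_of_small_singular_value (P : 'I_N -> 'M[R]_n) (eps : R) :
  (0 < N)%N -> 0 < eps -> (forall l, SO (P l)) ->
  smallest_singular_value (D_infty e P) <= eps ->
  exists i, near_span (2 * eps * N%:R) i P.
Proof.
move=> N0 eps0 PSO /(smallest_singular_value_le _ N0 (ltW eps0)) h.
have [k] := ltr_add_invr eps0; rewrite add0r => ke.
have [c] := h k; set D := D_infty e P; set b := eps + _.
have b0 : 0 < b by rewrite addr_gt0 ?invr_gt0.
rewrite qformB -scalemx1 qformZ qform1 subr_lt0 qform_gram.
have sD : D^T = D.
  by rewrite /D (D_inftyE e_ord) //; apply/matrixP => i j; rewrite !mxE fdotC.
rewrite sD => cD.
have c0 : c != 0 by apply: contraTneq cD => ->; rewrite mul0mx fdot0r mulr0 ltxx.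
have cc := fdot_gt0 c0.
have qD : qform D c = fdot (c *m D) c.
  by rewrite /qform fdotC /fdot mxtrace_mulC /mxtrace big_ord1.
have qlt : qform D c < b * fdot c c.
  rewrite ltNge; apply/negP => qge.
  have h1 : (b * fdot c c) ^+ 2 <= qform D c ^+ 2.
    have bc0 : 0 <= b * fdot c c by rewrite mulr_ge0 // ltW.
    by apply: (lerXn2r 2 _ _ qge); rewrite nnegrE ?(le_trans bc0 qge).
  have h2 : qform D c ^+ 2 < b ^+ 2 * fdot c c * fdot c c.
    by rewrite qD (le_lt_trans (fdot_CS _ _)) // ltr_pM2r.
  by have := le_lt_trans h1 h2; rewrite exprMn -mulrA -expr2 ltxx.
have [a [i ci]] := fdot_large_entry c0; rewrite mul1n ord1 in ci.
exists i, c; apply: (lt_le_trans qlt).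
apply: (@le_trans _ _ (b * (N%:R * c 0 i ^+ 2))).
  by rewrite ler_wpM2l // ltW.
have b2 : b <= 2 * eps by rewrite /b mulr2n mulrDl !mul1r lerD2l ltW.
by rewrite -[leRHS]mulrA ler_wpM2r // mulr_ge0 ?sqr_ge0.
Qed.

Variables (d : measure_display) (T : measurableType d) (Pr : probability T R).
Variables (mu : probability (mx_borel R n) R).
Variable P : 'I_N -> {RV Pr >-> mx_borel R n}.
Hypothesis mu_haar : normalized_haar_SO mu.
Hypothesis P_indep : mutually_independent P.
Hypothesis P_ident : identically_distributed P mu.

Lemma measurable_family_preimage (E : set (mx_family_borel R n N)) :
  measurable E -> measurable [set w | E (family P w)].
Proof.
move=> mE; rewrite -[X in measurable X]setTI.
exact: (measurable_family_map P (fun l => @measurable_id _ _ setT) measurableT mE).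
Qed.

Lemma measurable_family_SO : measurable [set w | forall l, SO (P l w : 'M[R]_n)].
Proof.
apply: (@measurable_family_preimage [set Q | forall l, SO (Q l)]).
by apply: sub_sigma_algebra; exists (fun=> @SO R n) => // l; exact: measurable_SO.
Qed.

Lemma measurable_twist (i : 'I_N) (h : 'M[R]_n) (l : 'I_N) :
  measurable_fun setT (twist i h l : mx_borel R n -> mx_borel R n).
Proof.
apply: mx_measurable_borel; rewrite /twist.
case: (l == i).
  exact: mx_measurableM (@mx_measurable_borel_id R n) (mx_measurable_cst _).
case: (l == i.+1 :> nat); last exact: mx_measurable_borel_id.
exact: mx_measurableM (mx_measurable_cst _) (@mx_measurable_borel_id R n).
Qed.

Lemma haar_twist (i : 'I_N) (h : 'M[R]_n) (l : 'I_N) (B : set (mx_borel R n)) :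
  SO h -> measurable B -> mu (twist i h l @^-1` B) = mu B.
Proof.
move=> hSO mB; rewrite /twist.
case: (l == i); first exact: haar_right.
by case: (l == i.+1 :> nat) => //; apply: haar_left => //; exact: SOT.
Qed.

(** The event is intersected with the almost sure one that all P_l are
    rotations, where the pointwise count of bad twists applies. *)
Lemma prob_near_span (M : nat) (eps eta : R) (i : 'I_N) :
  (0 < M)%N -> 0 <= eps -> 0 <= eta ->
  (n%:R * M%:R ^+ (2 * n)) ^+ 2 * eps <= eta ^+ 2 ->
  n%:R * ((2 * M%:R + 3) ^+ n) ^+ 2 * eta < 1 ->
  (Pr [set w | near_span eps i (family P w)] <= (2 * n%:R / M%:R)%:E)%E.
Proof.
move=> M0 eps0 eta0 Beta Xeta.
have /choice[h hE] : forall k : 'I_M * 'I_M, exists hk : 'M[R]_n, SO hk /\ exists x,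
     wedge (moment_vec R n k.1) (moment_vec R n k.2) =
     x *: (hk *m wedge (delta_mx (e i).1 0) (delta_mx (e i).2 0) *m hk^T) /\
     x ^+ 2 <= (n%:R * M%:R ^+ (2 * n)) ^+ 2.
  move=> k.
  have e12 : (e i).1 != (e i).2 by rewrite -val_eqE ltn_eqF // e_lt.
  have [g [x [gSO xE xB]]] :=
    wedge_SO (moment_vec R n k.1) (moment_vec R n k.2) e12.
  exists g; split => //; exists x; split => //; apply: le_trans xB _.
  by rewrite expr2 ler_pM ?fdot_ge0 // moment_vec_norm.
have mu1 := prob_SO P_indep P_ident mu_haar.1.
pose A k := [set w | near_span eps i (fun l => twist i (h k) l (P l w))]
  `&` [set w | forall l, SO (P l w : 'M[R]_n)].
have mtw k : measurable [set w | near_span eps i (fun l => twist i (h k) l (P l w))].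
  rewrite -[X in measurable X]setTI.
  exact: (measurable_family_map P (fun l => measurable_twist i (h k) l) measurableT
    (measurable_near_span eps i)).
have mA k : measurable (A k).
  by apply: measurableI => //; exact: measurable_family_SO.
have PrA k : Pr (A k) = Pr [set w | near_span eps i (family P w)].
  rewrite probability_setI_full //; last exact: measurable_family_SO.
  apply: (law_invariant P_indep P_ident) => //.
  - by move=> l; exact: measurable_twist.
  - by move=> l B; apply: haar_twist; case: (hE k).
  - exact: measurable_near_span.
have ov w : (#|[set k | `[< A k w >]]%SET| <= 2 * n * M)%N.
  have [PSO|nPSO] := pselect (forall l, SO (P l w : 'M[R]_n)); last first.
    rewrite (_ : [set k | _]%SET = finset.set0) ?cards0 //.
    by apply/setP => k; rewrite !inE; apply/asboolP => -[_ /nPSO].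
  apply: leq_trans (card_bad_twists e_ord PSO hE eps0 eta0 Beta Xeta).
  apply: subset_leq_card; apply/fintype.subsetP => k.
  by rewrite !inE => -[].
have := prob_le_of_overlap mA PrA ov.
have pfin : Pr [set w | near_span eps i (family P w)] \is a fin_num.
  apply: fin_num_measure.
  exact: measurable_family_preimage (measurable_near_span _ _).
rewrite -(fineK pfin) -EFinM !lee_fin card_prod card_ord.
have M0' : 0 < M%:R :> R by rewrite ltr0n.
rewrite !natrM ler_pdivlMr // => le.
by rewrite -(ler_pM2r M0') -mulrA mulrC.
Qed.

Lemma prob_small_singular_value (M : nat) (eps eta : R) :
  (0 < N)%N -> (0 < M)%N -> 0 < eps -> 0 <= eta ->
  (n%:R * M%:R ^+ (2 * n)) ^+ 2 * (2 * eps * N%:R) <= eta ^+ 2 ->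
  n%:R * ((2 * M%:R + 3) ^+ n) ^+ 2 * eta < 1 ->
  (Pr [set w | (smallest_singular_value (D_infty e (fun i => P i w)) <= eps)%R]
    <= (N%:R * (2 * n%:R / M%:R))%:E)%E.
Proof.
move=> N0 M0 eps0 eta0 Beta Xeta.
have mF : measurable [set w | smallest_singular_value (D_infty e (fun i => P i w)) <= eps].
  exact: (measurable_family_preimage (measurable_small_singular_value N0 (ltW eps0))).
have mE i : measurable [set w | near_span (2 * eps * N%:R) i (family P w)].
  exact: measurable_family_preimage (measurable_near_span _ _).
rewrite -(probability_setI_full mF measurable_family_SO (prob_SO P_indep P_ident mu_haar.1)).
apply: (@le_trans _ _ (\sum_(i < N) Pr [set w | near_span (2 * eps * N%:R) i (family P w)])%E).
  apply: prob_union_bound => // [|w [/= sw wSO]].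
    by apply: measurableI => //; exact: measurable_family_SO.
  exact: near_span_of_small_singular_value.
apply: (@le_trans _ _ (\sum_(i < N) (2 * n%:R / M%:R)%:E)%E).
  apply: lee_sum => i _; apply: prob_near_span Beta Xeta => //.
  by rewrite !mulr_ge0 // ltW.
by rewrite sumEFin sumr_const card_ord [N%:R * _]mulr_natl.
Qed.

End Events.

(** * The limit *)

Lemma nb_planesE n : (2 * nb_planes n = n * n.-1)%N.
Proof.
rewrite /nb_planes mulnC divnK //; case: n => [|n] //=.
by rewrite dvdn2 oddM /= andNb.
Qed.

(** The left-hand side is at most n^(36n+5) N, the powers 20n and 16n coming
    from the two factors with n in the exponent, while N - 1 is at least 49n. *)
Lemma threshold_bound n : (100 <= n)%N ->
  (8 * n ^ 4 * ((2 * n ^ 4 + 3) ^ n) ^ 4 * (n ^ 4) ^ (4 * n) * nb_planes n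
     <= nb_planes n ^ nb_planes n)%N.
Proof.
move=> n100; have nE := nb_planesE n; set N := nb_planes n in nE *.
have Nn : (49 * n + 1 <= N)%N by nia.
have X5 : (2 * n ^ 4 + 3 <= n ^ 5)%N.
  rewrite (expnS n 4); have : (0 < n ^ 4)%N by rewrite expn_gt0; lia.
  by nia.
have XX : (((2 * n ^ 4 + 3) ^ n) ^ 4 <= n ^ (20 * n))%N.
  rewrite -expnM (_ : 20 * n = 5 * (n * 4))%N; last by lia.
  by rewrite [leqRHS]expnM leq_exp2r //; lia.
have YY : ((n ^ 4) ^ (4 * n) = n ^ (16 * n))%N by rewrite -expnM; congr expn; lia.
have le : (8 * n ^ 4 * ((2 * n ^ 4 + 3) ^ n) ^ 4 * (n ^ 4) ^ (4 * n) <= n ^ (36 * n + 5))%N.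
  rewrite YY (_ : 36 * n + 5 = 1 + 4 + 20 * n + 16 * n)%N; last by lia.
  rewrite 3!expnD expn1; apply: leq_mul (leqnn _); apply: leq_mul XX.
  by apply: leq_mul (leqnn _); lia.
have -> : (N ^ N = N ^ N.-1 * N)%N by rewrite -expnSr prednK //; lia.
rewrite leq_mul2r; apply/orP; right; apply: leq_trans le _.
apply: (@leq_trans (N ^ (36 * n + 5))).
  by rewrite leq_exp2r; lia.
by rewrite leq_exp2l; lia.
Qed.

Theorem lemma6p9 (R : realType)
    (e : forall n : nat, 'I_(nb_planes n) -> 'I_n * 'I_n)
    (d : nat -> measure_display) (T : forall n : nat, measurableType (d n))
    (Pr : forall n : nat, probability (T n) R)
    (mu : forall n : nat, probability (mx_borel R n) R)
    (P : forall n : nat, 'I_(nb_planes n) -> {RV (Pr n) >-> mx_borel R n})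
    (e_ordering : forall n : nat, (2 <= n)%N -> plane_ordering (e n))
    (mu_haar : forall n : nat, (2 <= n)%N -> normalized_haar_SO (mu n))
    (P_indep : forall n : nat, (2 <= n)%N -> mutually_independent (P n))
    (P_ident : forall n : nat, (2 <= n)%N ->
       identically_distributed (P n) (mu n)) :
  (fun n : nat =>
     let N := nb_planes n in
     Pr n [set w : T n |
       smallest_singular_value (D_infty (e n) (fun i => P n i w)) <=
       N%:R ^- N * (4 * N%:R ^+ 21) ^- (4 * (N + 1))])
    @ \oo --> (0 : \bar R)%E.
Proof.
have main n : (100 <= n)%N ->
    (Pr n [set w : T n |
       (smallest_singular_value (D_infty (e n) (fun i => P n i w)) <=
       (nb_planes n)%:R ^- nb_planes n *
         (4 * (nb_planes n)%:R ^+ 21) ^- (4 * (nb_planes n + 1)))%R]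
     <= (n%:R^-1)%:E)%E.
  move=> n100; have nE := nb_planesE n; have tb := threshold_bound n100.
  set N := nb_planes n in nE tb *.
  have n2 : (2 <= n)%N by lia.
  have N0 : (0 < N)%N by nia.
  have Nr : 0 < N%:R :> R by rewrite ltr0n.
  have nr : 0 < n%:R :> R by rewrite ltr0n; lia.
  set eps := N%:R ^- N * _.
  have c1 : 1 <= (4 * N%:R ^+ 21) ^+ (4 * (N + 1)) :> R.
    by rewrite -!natrX -natrM -natrX ler1n !expn_gt0 muln_gt0 expn_gt0 N0.
  have c0 := lt_le_trans ltr01 c1.
  have eps0 : 0 < eps by rewrite mulr_gt0 // invr_gt0 // exprn_gt0.
  have epsN : eps * N%:R ^+ N <= 1.
    rewrite /eps mulrAC mulVf ?mul1r; last by rewrite gt_eqF // exprn_gt0.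
    by rewrite invf_le1.
  (* M has to exceed the order n^3 of n N *)
  pose M := (n ^ 4)%N.
  pose X : R := (2 * M%:R + 3) ^+ n.
  have X0 : 0 < X by rewrite exprn_gt0 // ltr_wpDl.
  (* half of the bound under which the bad pairs are counted *)
  pose eta : R := (2 * (n%:R * X ^+ 2))^-1.
  have nX : 0 < n%:R * X ^+ 2 by rewrite mulr_gt0 // exprn_gt0.
  have eta0 : 0 < eta by rewrite invr_gt0 mulr_gt0.
  have etaX : n%:R * X ^+ 2 * eta < 1.
    by rewrite /eta invfM mulrCA divff ?gt_eqF // mulr1 invf_lt1 // ltr1n.
  have tbR : 8 * n%:R ^+ 4 * X ^+ 4 * M%:R ^+ (4 * n) * N%:R * eps <= 1.
    apply: le_trans epsN; rewrite [leRHS]mulrC ler_wpM2r ?(ltW eps0) //.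
    have := tb; rewrite -(ler_nat R) !natrM !natrX natrD natrM natrX.
    by rewrite /X /M natrX.
  have Beta : (n%:R * M%:R ^+ (2 * n)) ^+ 2 * (2 * eps * N%:R) <= eta ^+ 2.
    have e4 : (2 * (n%:R * X ^+ 2)) ^+ 2 * ((n%:R * M%:R ^+ (2 * n)) ^+ 2 * (2 * eps * N%:R))
      = 8 * n%:R ^+ 4 * X ^+ 4 * M%:R ^+ (4 * n) * N%:R * eps.
      rewrite (_ : (4 * n = 2 * n * 2)%N); last by rewrite mulnAC.
      rewrite [M%:R ^+ (2 * n * 2)]exprM; ring.
    by rewrite /eta exprVn -div1r ler_pdivlMr ?exprn_gt0 ?mulr_gt0 // mulrC e4.
  have M0 : (0 < M)%N by rewrite expn_gt0 (leq_trans _ n100).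
  apply: le_trans (prob_small_singular_value (e_ordering n n2) (mu_haar n n2)
    (P_indep n n2) (P_ident n n2) N0 M0 eps0 (ltW eta0) Beta etaX) _.
  have Mr : 0 < M%:R :> R by rewrite ltr0n.
  rewrite lee_fin mulrA ler_pdivrMr // ler_pdivlMl // -!natrM ler_nat.
  rewrite /M (expnS n 3) (expnS n 2) leq_mul2l; apply/orP; right.
  rewrite mulnA (mulnC N) nE -mulnA leq_mul //.
  by rewrite expnS expn1 leq_mul2r leq_pred orbT.
apply: (@squeeze_cvge _ _ _ _ (fun=> 0%E) _ (fun n => (n%:R^-1 : R)%:E)).
- near=> n; rewrite measure_ge0 /=; apply: main; near: n.
  by exists 100%N.
- exact: cvg_cst.
- have inv_cvg : (n%:R^-1 : R) @[n --> \oo] --> (0 : R).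
    by rewrite -cvg_shiftS; exact: cvg_harmonic.
  by apply: cvg_EFin => //; exact: nearW.
Unshelve. all: by end_near.
Qed.
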